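(* Let $\mathcal{J}^*$ be the minimum of the limit $$\lim_{T\to\infty}\frac1T\frac2\beta\log\mathbb{E}\exp\Big[\frac\beta2\sum_{t=0}^{T-1}c(x_t,u_t)\Big],\qquad u_t=\mu_t(x_{0:t},u_{0:t-1}),$$ over control policies $\{\mu_t\}_{t\ge0}$, and suppose that the following modified Riccati equation admits a stabilizing fixed-point solution $P_{K^*}\ge0$ such that $W^{-1}-\beta P_{K^*}>0$: $$P_{K^*}=Q+(K^* )^\top RK^*+(A-BK^* )^\top\tilde P_{K^*}(A-BK^* ),$$ $$\tilde P_{K^*}=P_{K^*}+\beta P_{K^*}(W^{-1}-\beta P_{K^*})^{-1}P_{K^*},$$ $$K^*=(R+B^\top\tilde P_{K^*}B)^{-1}B^\top\tilde P_{K^*}A.$$ Then $\mathcal{J}^*=-\beta^{-1}\log\det(I-\beta P_{K^*}W)$. Moreover, among all controls that generate a well-defined objective (i.e., for which the limit $\lim_{T\to\infty}\frac1T\frac2\beta\log\mathbb{E}\exp\big[\frac\beta2\sum_{t=0}^{T-1}c(x_t,u_t)\big]$ exists), the optimal control is linear time-invariant state-feedback, given by $\mu_t(x_{0:t},u_{0:t-1})=-K^*x_t$ for all $t\ge0$.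
   Context: Setting (infinite-horizon state-feedback linear exponential quadratic Gaussian, LEQG, problem). The state $x_t\in\mathbb{R}^m$ and control $u_t\in\mathbb{R}^d$ follow $x_{t+1}=Ax_t+Bu_t+w_t$ for $t\ge0$, with $A,B$ real matrices of proper dimensions, $x_0\sim\mathcal{N}(0,X_0)$, $w_t\sim\mathcal{N}(0,W)$ all independent, and $X_0,W$ positive definite. The one-stage cost is $c(x,u)=x^\top Qx+u^\top Ru$ with $Q,R$ positive definite. $\beta>0$ is the risk-sensitivity parameter. A control policy is a sequence of maps $\mu_t:(\mathbb{R}^m\times\mathbb{R}^d)^t\times\mathbb{R}^m\to\mathbb{R}^d$ taking the history of states $x_{0:t}$ and controls $u_{0:t-1}$ to $u_t$. The solution $P_{K^*}$ is stabilizing if $\rho\big((I-\beta P_{K^*}W)^{-\top}(A-BK^* )\big)<1$, with $\rho(\cdot)$ the spectral radius and $X^{-\top}=(X^{-1})^\top$; $X>0$ ($X\ge0$) denotes (symmetric) positive definite (semidefinite).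
   Formalization: The formal theorem adds the hypothesis that X_0^{-1} - βP_{K*} is positive definite; without it the claim fails (A=B=0, Q=1/2, X_0=2, β=W=R=1 gives an infinite objective for every policy, not log 2). *)

(* Defs.v *)
From HB Require Import structures.
From mathcomp Require Import all_boot all_order all_algebra finmap complex.
From mathcomp Require Import all_classical all_reals all_analysis.

Set Implicit Arguments.
Unset Strict Implicit.
Unset Printing Implicit Defensive.

Import Order.TTheory GRing.Theory Num.Theory.
Import numFieldNormedType.Exports.

Local Open Scope classical_set_scope.
Local Open Scope ring_scope.

(** * Borel structure on matrices *)

Definition measure_matrix_display : measure_display -> measure_display.
Proof. exact. Qed.

Section measurable_matrix.
Context {d : measure_display} {T : measurableType d} (m n : nat).

Definition matrix_cylinders : set (set 'M[T]_(m, n)) :=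
  [set A | exists i j, exists2 B : set T,
     measurable B & A = [set M : 'M[T]_(m, n) | B (M i j)]].

Let matrix_measurable : set (set 'M[T]_(m, n)) := <<s matrix_cylinders >>.

Let matrix_measurable0 : matrix_measurable set0.
Proof. exact: sigma_algebra0. Qed.

Let matrix_measurableC A : matrix_measurable A -> matrix_measurable (~` A).
Proof. exact: sigma_algebraC. Qed.

Let matrix_measurable_bigcup (F : (set 'M[T]_(m, n))^nat) :
  (forall i, matrix_measurable (F i)) -> matrix_measurable (\bigcup_i F i).
Proof. exact: sigma_algebra_bigcup. Qed.

HB.instance Definition _ := @isMeasurable.Build (measure_matrix_display d)
  'M[T]_(m, n) matrix_measurable
  matrix_measurable0 matrix_measurableC matrix_measurable_bigcup.

End measurable_matrix.

(** * Matrices *)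

Section matrices.
Context {R : realType} {n : nat}.
Implicit Types (S : 'M[R]_n) (v : 'cV[R]_n).

Definition quadratic_form S v : R := (v^T *m S *m v) 0 0.

Definition posdef S : Prop :=
  S^T = S /\ forall v, v != 0 -> 0 < quadratic_form S v.

Definition possemidef S : Prop :=
  S^T = S /\ forall v, 0 <= quadratic_form S v.

(* [eigenvalue] only sees the roots lying in the base field, hence the passage
   to R[i].  The set is finite, and empty only if n = 0, where the radius is 0. *)
Definition spectral_radius S : R :=
  sup [set ComplexField.Normc.normc lam | lam in
         [set lam : R[i] | eigenvalue (map_mx (real_complex R) S) lam]].

End matrices.

(** * Gaussian vectors and independence *)

Section probability.
Context {dO : measure_display} {Omega : measurableType dO} {R : realType}.
Variable P : probability Omega R.

Definition mutually_independent (I : choiceType) (dE : measure_display)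
    (E : measurableType dE) (X : I -> Omega -> E) : Prop :=
  forall (J : {fset I}) (B : I -> set E),
    (forall i, i \in J -> measurable (B i)) ->
    P (\bigcap_(i in [set` J]) X i @^-1` B i)
      = (\prod_(i <- J) P (X i @^-1` B i))%E.

Definition standard_normal (Z : {RV P >-> R}) : Prop :=
  forall B : set R, measurable B -> distribution P Z B = normal_prob 0 1 B.

(* N(0, S): a linear image L Z, with L L^T = S, of a vector Z of independent
   standard normal variables.  Such an L is invertible when S is positive
   definite, so that asking for Z on Omega itself loses no generality there. *)
Definition centered_gaussian (n : nat) (S : 'M[R]_n)
    (X : {RV P >-> 'cV[R]_n}) : Prop :=
  exists (L : 'M[R]_n) (Z : 'I_n -> {RV P >-> R}),
    [/\ L *m L^T = S,
        forall i, standard_normal (Z i),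
        mutually_independent (fun i => Z i : Omega -> R) &
        forall omega, X omega = L *m \col_i Z i omega].

End probability.

(** * Controlled linear system *)

Section control.
Context {R : realType} {m d : nat}.

(* ((x_0, u_0), ..., (x_(t-1), u_(t-1))), x_t *)
Definition history (t : nat) : Type :=
  (t.-tuple ('cV[R]_m * 'cV[R]_d) * 'cV[R]_m)%type.

Definition policy : Type := forall t, history t -> 'cV[R]_d.

Definition measurable_policy (mu : policy) : Prop :=
  forall t, measurable_fun
    [set: t.-tuple ('cV[R]_m * 'cV[R]_d) * 'cV[R]_m] (mu t).

Definition linear_state_feedback (K : 'M[R]_(d, m)) : policy :=
  fun t h => - (K *m h.2).

Variables (A : 'M[R]_m) (B : 'M[R]_(m, d)).

Section trajectory.
Variables (mu : policy) (x0 : 'cV[R]_m) (w : nat -> 'cV[R]_m).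

Fixpoint trajectory (t : nat) : history t :=
  match t with
  | 0 => ([tuple], x0)
  | s.+1 =>
      let h := trajectory s in
      let u := mu h in
      ([tuple of rcons h.1 (h.2, u)], A *m h.2 + B *m u + w s)
  end.

Definition state (t : nat) : 'cV[R]_m := (trajectory t).2.

Definition control (t : nat) : 'cV[R]_d := mu (trajectory t).

End trajectory.

Variables (Q : 'M[R]_m) (Ru : 'M[R]_d) (beta : R).

Definition stage_cost (x : 'cV[R]_m) (u : 'cV[R]_d) : R :=
  quadratic_form Q x + quadratic_form Ru u.

Context {dO : measure_display} {Omega : measurableType dO}.
Variables (P : probability Omega R).
Variables (x0 : Omega -> 'cV[R]_m) (w : nat -> Omega -> 'cV[R]_m).

Definition total_cost (mu : policy) (T : nat) (omega : Omega) : R :=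
  let wo := fun t => w t omega in
  \sum_(t < T) stage_cost (state mu (x0 omega) wo t)
                          (control mu (x0 omega) wo t).

(* The expectation may be +oo, and then so is the value. *)
Definition leqg_cost (mu : policy) (T : nat) : \bar R :=
  ((T%:R^-1 * (2 / beta))%:E *
   lne 'E_P[fun omega => expR (beta / 2 * total_cost mu T omega)])%E.

Definition leqg_objectives : set (\bar R) :=
  [set l | exists2 mu, measurable_policy mu & leqg_cost mu @ \oo --> l].

Definition is_minimum (S : set (\bar R)) (l : \bar R) : Prop :=
  S l /\ lbound S l.

(* [measurable_policy] and convergence make this "optimal among the policies
   whose objective is well defined". *)
Definition optimal_policy (mu : policy) : Prop :=
  measurable_policy mu /\
  exists2 l, leqg_cost mu @ \oo --> l & is_minimum leqg_objectives l.

End control.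

Arguments history : clear implicits.
Arguments policy : clear implicits.

(* Main.v *)
(* Completing the square in the noise and in the control shows that, whatever the
   policy, E exp (beta / 2 (cost up to t + x_t' Y x_t)) is multiplied at each step
   by at least det (I - beta Y W)^(-1/2) when Y is replaced by its Riccati
   image, with equality for the gain of Y.  For the policy - K x and Y = P_K this
   bounds the objective from above.  Started from the terminal weight 0, the
   Riccati iterates increase to P_K; by Cesaro, the determinants they contribute
   give the matching lower bound for every policy.

   That the iterates reach P_K is where stability enters.  Their limit L satisfies
   P_K - L = F' (P_K - L) N with F, N the closed loops of P_K and L.  If P_K - L
   were nonzero, an eigenvector of F modulo its kernel would give a complex row z
   with lam z N = z and |lam| < 1, and subtracting a small multiple of |z v|^2
   from L would produce a supersolution of the Riccati equation, hence an upper
   bound of the iterates, strictly below their limit. *)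

Require Import Defs.
From HB Require Import structures.
From mathcomp Require Import all_boot all_order all_algebra finmap complex.
From mathcomp Require Import all_classical all_reals all_analysis.
From mathcomp Require Import measurable_realfun ring lra.

Set Implicit Arguments.
Unset Strict Implicit.
Unset Printing Implicit Defensive.

Import Order.TTheory GRing.Theory Num.Theory.
Import numFieldNormedType.Exports.

Local Open Scope classical_set_scope.
Local Open Scope ring_scope.

(** * Quadratic forms and positive definite matrices *)

Definition dot {R : realType} {n} (u v : 'cV[R]_n) : R := (u^T *m v) 0 0.

Section dot.
Context {R : realType}.

Lemma dotC n (u v : 'cV[R]_n) : dot u v = dot v u.
Proof.
by rewrite /dot -[in LHS](trmxK v) -trmx_mul mxE.
Qed.

Lemma dotDl n (u v w : 'cV[R]_n) : dot (u + v) w = dot u w + dot v w.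
Proof. by rewrite /dot linearD mulmxDl mxE. Qed.

Lemma dotDr n (u v w : 'cV[R]_n) : dot w (u + v) = dot w u + dot w v.
Proof. by rewrite /dot mulmxDr mxE. Qed.

Lemma dotNl n (u w : 'cV[R]_n) : dot (- u) w = - dot u w.
Proof. by rewrite /dot linearN mulNmx mxE. Qed.

Lemma dotNr n (u w : 'cV[R]_n) : dot w (- u) = - dot w u.
Proof. by rewrite /dot mulmxN mxE. Qed.

Lemma dotZl n a (u w : 'cV[R]_n) : dot (a *: u) w = a * dot u w.
Proof. by rewrite /dot linearZ /= -scalemxAl mxE. Qed.

Lemma dotZr n a (u w : 'cV[R]_n) : dot w (a *: u) = a * dot w u.
Proof. by rewrite /dot -scalemxAr mxE. Qed.

Definition dotE := (dotDl, dotDr, dotNl, dotNr, dotZl, dotZr).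

Lemma dot_mull n p (M : 'M[R]_(n, p)) u v : dot (M *m u) v = dot u (M^T *m v).
Proof. by rewrite /dot trmx_mul mulmxA. Qed.

Lemma dot_outer n (c x y : 'cV[R]_n) : dot x (c *m c^T *m y) = dot c x * dot c y.
Proof.
rewrite -mulmxA (dotC x) dot_mull {1}/dot trmx_mul trmxK mxE big_ord1 mulrC.
by congr (_ * _); exact: dotC.
Qed.

Lemma dot_eq0 n (u : 'cV[R]_n) : dot u u = 0 -> u = 0.
Proof.
rewrite /dot mxE => /eqP; rewrite psumr_eq0; last first.
  by move=> i _; rewrite mxE -expr2 sqr_ge0.
move=> /allP h; apply/matrixP => i j; rewrite (ord1 j) [RHS]mxE.
have /implyP/(_ isT) := h i (mem_index_enum i).
by rewrite mxE mulf_eq0 orbb => /eqP.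
Qed.

Lemma dot_col_mx n p (a b : 'cV[R]_n) (y z : 'cV[R]_p) :
  dot (col_mx a y) (col_mx b z) = dot a b + dot y z.
Proof. by rewrite /dot tr_col_mx mul_row_col mxE. Qed.

Lemma qfE n (S : 'M[R]_n) v : quadratic_form S v = dot v (S *m v).
Proof. by rewrite /dot /quadratic_form mulmxA. Qed.

Lemma qfDl n (S T : 'M[R]_n) v :
  quadratic_form (S + T) v = quadratic_form S v + quadratic_form T v.
Proof. by rewrite !qfE mulmxDl dotDr. Qed.

Lemma qfNl n (S : 'M[R]_n) v : quadratic_form (- S) v = - quadratic_form S v.
Proof. by rewrite !qfE mulNmx dotNr. Qed.

Lemma qfZl n a (S : 'M[R]_n) v : quadratic_form (a *: S) v = a * quadratic_form S v.
Proof. by rewrite !qfE -scalemxAl dotZr. Qed.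

Lemma qf_congr n p (S : 'M[R]_n) (M : 'M[R]_(n, p)) v :
  quadratic_form (M^T *m S *m M) v = quadratic_form S (M *m v).
Proof. by rewrite !qfE dot_mull !mulmxA. Qed.

Lemma trmx_congr n p (S : 'M[R]_n) (M : 'M[R]_(n, p)) : S^T = S ->
  (M^T *m S *m M)^T = M^T *m S *m M.
Proof. by move=> symS; rewrite !trmx_mul trmxK symS mulmxA. Qed.

Lemma qf0r n (S : 'M[R]_n) : quadratic_form S 0 = 0.
Proof. by rewrite qfE mulmx0 /dot mulmx0 mxE. Qed.

Lemma qf0l n v : quadratic_form (0 : 'M[R]_n) v = 0.
Proof. by rewrite qfE mul0mx /dot mulmx0 mxE. Qed.

Lemma qfD n (S : 'M[R]_n) u v : S^T = S ->
  quadratic_form S (u + v) =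
  quadratic_form S u + 2 * dot u (S *m v) + quadratic_form S v.
Proof.
move=> symS; rewrite !qfE mulmxDr !dotE.
have -> : dot v (S *m u) = dot u (S *m v) by rewrite dotC dot_mull symS.
by ring.
Qed.

Lemma qfNr n (S : 'M[R]_n) v : quadratic_form S (- v) = quadratic_form S v.
Proof. by rewrite !qfE mulmxN dotNl dotNr opprK. Qed.

Lemma qf_polar n (S : 'M[R]_n) i j : S^T = S ->
  2 * S i j = quadratic_form S (delta_mx i 0 + delta_mx j 0)
    - quadratic_form S (delta_mx i 0) - quadratic_form S (delta_mx j 0).
Proof.
move=> symS; rewrite qfD //.
have -> : dot (delta_mx i 0) (S *m delta_mx j 0) = S i j.
  rewrite /dot -colE mxE (bigD1 i) //= big1; last first.
    by move=> k ki; rewrite !mxE (negbTE ki) mul0r.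
  by rewrite !mxE !eqxx mul1r addr0.
by ring.
Qed.

Lemma posdef_ge0 n (S : 'M[R]_n) v : posdef S -> 0 <= quadratic_form S v.
Proof.
move=> [_ S0]; have [->|v0] := eqVneq v 0; first by rewrite qf0r.
exact/ltW/S0.
Qed.

Lemma posdef_unit n (S : 'M[R]_n) : posdef S -> S \in unitmx.
Proof.
move=> [symS S0]; rewrite unitmxE unitfE; apply/det0P => -[v v0 vS].
have /S0 : v^T != 0 by rewrite -trmx0 (inj_eq trmx_inj).
by rewrite /quadratic_form trmxK vS mul0mx mxE ltxx.
Qed.

Lemma posdefD n (S T : 'M[R]_n) : posdef S -> T^T = T ->
  (forall v, 0 <= quadratic_form T v) -> posdef (S + T).
Proof.
move=> [symS S0] symT T0; split; first by rewrite linearD /= symS symT.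
by move=> v v0; rewrite qfDl ltr_pwDl // S0.
Qed.

Lemma posdef_congr n (S M : 'M[R]_n) :
  posdef S -> M \in unitmx -> posdef (M^T *m S *m M).
Proof.
move=> [symS S0] uM; split; first by rewrite !trmx_mul trmxK symS mulmxA.
move=> v v0; rewrite qf_congr S0 //; apply: contra_neq v0 => Mv.
by rewrite -[v](mulKmx uM) Mv mulmx0.
Qed.

Lemma posdef_inv n (S : 'M[R]_n) : posdef S -> posdef (invmx S).
Proof.
move=> pS; have uS := posdef_unit pS; have [symS _] := pS.
have symI : (invmx S)^T = invmx S by rewrite trmx_inv symS.
have -> : invmx S = (invmx S)^T *m S *m invmx S by rewrite symI mulVmx // mul1mx.
by apply: posdef_congr; rewrite // unitmx_inv.
Qed.

Lemma dot_block n (a : R) (c : 'cV[R]_n) (D : 'M[R]_n) s t x y :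
  dot (col_mx s%:M t) (block_mx a%:M c^T c D *m col_mx x%:M y) =
  a * s * x + s * dot c y + x * dot c t + dot t (D *m y).
Proof.
have sc (u : R) (z : 'cV[R]_1) : dot u%:M z = u * z 0 0.
  by rewrite /dot tr_scalar_mx mul_scalar_mx mxE.
rewrite mul_block_col dot_col_mx sc dotDr (mul_mx_scalar _ c) dotZr [dot t c]dotC.
have -> : (a%:M *m x%:M + c^T *m y : 'M[R]_1) 0 0 = a * x + dot c y.
  by rewrite -scalar_mxM [LHS]mxE mxE eqxx mulr1n.
by ring.
Qed.

(** One step of block elimination: [N] is the Schur complement of the first diagonal entry. It
    drives the inductions on the dimension in [posdef_det] and [gaussian_expectation]. *)
Lemma posdef_block n (S : 'M[R]_(1 + n)) : posdef S ->
  exists a (c : 'cV[R]_n) D, let N := D - a^-1 *: (c *m c^T) in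
  [/\ 0 < a, posdef N, S = block_mx a%:M c^T c D & \det S = a * \det N].
Proof.
move=> [symS S0]; pose a := S 0 0; pose c := dlsubmx S.
exists a, c, (drsubmx S) => N.
have cT : ursubmx S = c^T by rewrite /c trmx_dlsub symS.
have aM : ulsubmx S = a%:M.
  rewrite [ulsubmx S]mx11_scalar; congr (_%:M); rewrite !mxE.
  by congr (S _ _); apply: val_inj.
have eS : S = block_mx a%:M c^T c (drsubmx S) by rewrite -aM -cT submxK.
have qS x0 (y : 'cV_n) : quadratic_form S (col_mx x0%:M y) =
    a * x0 ^+ 2 + 2 * x0 * dot c y + quadratic_form (drsubmx S) y.
  by rewrite !qfE {1}eS dot_block; ring.
have a0 : 0 < a.
  have /S0 : col_mx 1%:M 0 != 0 :> 'cV[R]_(1 + n).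
    rewrite col_mx_eq0 eqxx andbT; apply/negP => /eqP/matrixP/(_ 0 0).
    by rewrite !mxE /=; apply/eqP; rewrite oner_neq0.
  by rewrite qS qf0r /dot mulmx0 mxE; lra.
have symD : (drsubmx S)^T = drsubmx S by rewrite trmx_drsub symS.
split => //.
  split; first by rewrite linearB linearZ /= trmx_mul trmxK symD.
  (* [x0] minimizes the form of [S] over its first coordinate when the others are [y]; the minimum
     is the form of [N] at [y]. *)
  move=> y y0; pose x0 := - (a^-1 * dot c y).
  have /S0 : col_mx x0%:M y != 0 by rewrite col_mx_eq0 negb_and y0 orbT.
  rewrite qS /N qfDl qfNl qfZl (qfE (c *m c^T)) dot_outer -expr2.
  suff -> : a * x0 ^+ 2 + 2 * x0 * dot c y = - (a^-1 * dot c y ^+ 2) by lra.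
  by rewrite /x0; field; rewrite gt_eqF.
rewrite {1}eS.
have -> : block_mx a%:M c^T c (drsubmx S) =
   block_mx 1%:M 0 (a^-1 *: c) 1%:M *m block_mx a%:M c^T 0 N.
  rewrite mulmx_block !mul1mx !mul0mx !addr0 (mul_mx_scalar _ (_ *: c)) scalerA.
  by rewrite divff ?gt_eqF // scale1r /N -scalemxAl addrC subrK.
by rewrite det_mulmx det_lblock det_ublock !det1 !mul1r det_scalar1.
Qed.

Lemma posdef_det n (S : 'M[R]_n) : posdef S -> 0 < \det S.
Proof.
elim: n S => [|n IH] S pS; first by rewrite det_mx00.
by have [a [c [D [a0 /IH N0 _ ->]]]] := @posdef_block n S pS; rewrite mulr_gt0.
Qed.

(** Cauchy-Schwarz for the inner product of [S]: the row [f] is represented by the vector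
    [invmx S *m f^T], and nonnegativity of a quadratic polynomial in [t] bounds its discriminant. *)
Lemma posdef_bound n (S : 'M[R]_n) (f : 'rV[R]_n) : posdef S ->
  exists2 C, 0 <= C & forall v, ((f *m v) 0 0) ^+ 2 <= C * quadratic_form S v.
Proof.
move=> pS; have uS := posdef_unit pS; have [symS _] := pS.
have pI := posdef_inv pS.
exists (quadratic_form (invmx S) f^T); first exact: posdef_ge0.
move=> v; set g := invmx S *m f^T.
have fv : (f *m v) 0 0 = dot g (S *m v).
  by rewrite /g /dot trmx_mul trmxK trmx_inv symS mulmxA mulmxKV.
have gg : quadratic_form (invmx S) f^T = quadratic_form S g.
  rewrite !qfE /g; rewrite [RHS]dot_mull trmx_inv symS.
  by rewrite mulKVmx // mulKmx.
rewrite fv gg; set b := dot _ _; set p := quadratic_form S g.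
set q := quadratic_form S v.
have p0 : 0 <= p by exact: posdef_ge0.
have q0 : 0 <= q by exact: posdef_ge0.
have h t : 0 <= p + 2 * t * b + t ^+ 2 * q.
  have := posdef_ge0 (g + t *: v) pS.
  rewrite qfD // -scalemxAr dotZr -/b -/p.
  have -> : quadratic_form S (t *: v) = t ^+ 2 * q.
    by rewrite /q !qfE -scalemxAr dotZr dotZl; ring.
  lra.
have [q00|qn0] := eqVneq q 0.
  have b0 : b = 0.
    (* For [q = 0] the polynomial is affine; were its slope nonzero, it would take the value -1
       here. *)
    apply/eqP/negP => /negP b0; have := h (- (p + 1) / (2 * b)).
    rewrite q00 mulr0 addr0.
    have -> : p + 2 * (- (p + 1) / (2 * b)) * b = -1 by field.
    by lra.
  by rewrite b0 q00 expr0n mulr0.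
have qp : 0 < q by rewrite lt_neqAle eq_sym qn0.
have := h (- b / q).
have -> : p + 2 * (- b / q) * b + (- b / q) ^+ 2 * q = (p * q - b ^+ 2) / q.
  by field.
by rewrite pmulr_lge0 ?invr_gt0 // subr_ge0.
Qed.

End dot.

(** * Antistable rows and entrywise convergence *)

Section antistable.
Context {R : realType}.
Local Notation C := R[i].
Local Notation toC := (map_mx (real_complex R)).

(* Split the characteristic polynomial and multiply a row outside the kernel by
   the factors [M - z] one after the other: by Cayley-Hamilton the product ends
   in the kernel, and the last row outside it is the required [x]. *)
Lemma eigenrow_mod_ker (F : closedFieldType) n (M D : 'M[F]_n) : D != 0 ->
  exists2 lam, eigenvalue M lam &
    exists2 x : 'rV[F]_n, x *m D != 0 & x *m M *m D = lam *: (x *m D).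
Proof.
case: n M D => [|n] M D D0; first by rewrite (flatmx0 D) eqxx in D0.
have [i xD] : exists i, row i D != 0.
  apply/existsP; apply: contraNT D0; rewrite negb_exists => /forallP rD.
  by apply/eqP/row_matrixP => i; rewrite row0; apply/eqP; have := rD i; rewrite negbK.
rewrite rowE in xD; move: (delta_mx 0 i) xD => x xD.
have [s cs] := closed_field_poly_normal (char_poly M).
rewrite (monicP (char_poly_monic M)) scale1r in cs.
have sub_s : forall lam, lam \in s -> eigenvalue M lam.
  by move=> lam ls; rewrite eigenvalue_root_char cs root_prod_XsubC.
have : x *m horner_mx M (\prod_(z <- s) ('X - z%:P)) *m D = 0.
  by rewrite -cs Cayley_Hamilton mulmx0 mul0mx.
elim: s x xD sub_s {cs} => [|lam s IH] x xD sub_s.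
  by rewrite big_nil rmorph1 mulmx1 => xD0; rewrite xD0 eqxx in xD.
rewrite big_cons rmorphM rmorphB /= horner_mx_X horner_mx_C -mulmxE mulmxA.
have [xD0 _|xD0] := eqVneq (x *m (M - lam%:M) *m D) 0.
  exists lam; first by rewrite sub_s // mem_head.
  exists x => //; move: xD0; rewrite mulmxBr mulmxBl mul_mx_scalar -scalemxAl.
  by move/eqP; rewrite subr_eq0 => /eqP.
by apply: IH => // mu mus; apply: sub_s; rewrite inE mus orbT.
Qed.

Lemma eigenvalue_trmx (F : fieldType) n (M : 'M[F]_n) :
  eigenvalue M^T =1 eigenvalue M.
Proof.
move=> a; rewrite !eigenvalue_root_char /char_poly -det_tr /char_poly_mx.
by rewrite linearB /= tr_scalar_mx map_trmx trmxK.
Qed.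

Lemma spectral_radius_ub n (M : 'M[R]_n) lam : eigenvalue (toC M) lam ->
  ComplexField.Normc.normc lam <= spectral_radius M.
Proof.
move=> lM; apply: ub_le_sup; last by exists lam.
have [s cs] := closed_field_poly_normal (char_poly (toC M)).
rewrite (monicP (char_poly_monic _)) scale1r in cs.
(* [sup] dominates its set only once the set is bounded; the sum of the moduli of the roots of the
   characteristic polynomial is a bound. *)
exists (\sum_(z <- s) ComplexField.Normc.normc z) => _ [z zM <-].
have zs : z \in s by rewrite -root_prod_XsubC -cs -eigenvalue_root_char.
rewrite (big_rem z) //= lerDl sumr_ge0 // => y _.
by case: y => a b /=; rewrite sqrtr_ge0.
Qed.

(* For [z = a + i b] and an eigenvalue [lam] of [F], with [r = |lam|^2], this is
   the real form of [lam *: z *m N = z]. *)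
Lemma antistable_rows n (F N D : 'M[R]_n) :
  spectral_radius F < 1 -> D = F^T *m D *m N -> D != 0 ->
  exists (r : R) (a b : 'rV[R]_n), [/\ 0 <= r < 1, a != 0 \/ b != 0 &
    forall v : 'cV[R]_n, ((a *m v) 0 0) ^+ 2 + ((b *m v) 0 0) ^+ 2 =
      r * (((a *m (N *m v)) 0 0) ^+ 2 + ((b *m (N *m v)) 0 0) ^+ 2)].
Proof.
move=> rF eD D0.
have DC0 : toC D != 0 by rewrite map_mx_eq0.
have [lam lF [x xD xFD]] := eigenrow_mod_ker (toC F)^T DC0.
rewrite eigenvalue_trmx in lF.
(* Multiplying [D = F^T *m D *m N] by [x] on the left and using the eigenrow relation modulo the
   kernel of [D] gives the claim; the row [z] will be [x *m toC D]. *)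
have lz : lam *: (x *m toC D *m toC N) = x *m toC D.
  by rewrite [in RHS]eD !map_mxM /= -map_trmx !mulmxA xFD -scalemxAl.
move: (x *m toC D) xD lz => z z0 lz {x xFD DC0}.
have := le_lt_trans (spectral_radius_ub lF) rF.
case: lam lz {lF} => p q lz /= l1.
pose a := map_mx (@complex.Re R) z; pose b := map_mx (@complex.Im R) z.
have zab k : z 0 k = (a 0 k +i* b 0 k)%C by rewrite !mxE; case: (z 0 k).
exists (p ^+ 2 + q ^+ 2), a, b; split.
- rewrite addr_ge0 ?sqr_ge0 //=.
  have := l1; rewrite -[X in _ < X]sqrtr1 ltr_sqrt //.
- have [a0|] := eqVneq a 0; last by left.
  have [b0|] := eqVneq b 0; last by right.
  case/eqP: z0; apply/rowP => k; by rewrite zab a0 b0 !mxE.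
- have zN k : (z *m toC N) 0 k = ((a *m N) 0 k +i* (b *m N) 0 k)%C.
    rewrite !mxE.
    under eq_bigr do rewrite zab mxE.
    elim/big_ind3: _ => [//|? ? [? ?] ? ? [? ?] -> ->//|j _].
    by rewrite !mxE; apply/eqP; rewrite eq_complex /= !mulr0 subr0 add0r !eqxx.
  have aE : a = p *: (a *m N) - q *: (b *m N).
    apply/rowP => k; have /rowP/(_ k) := lz.
    rewrite mxE zN zab => -[<- _].
    by rewrite [RHS]mxE [X in _ = X + _]mxE [X in _ = _ + X]mxE [X in _ = _ - X]mxE.
  have bE : b = p *: (b *m N) + q *: (a *m N).
    apply/rowP => k; have /rowP/(_ k) := lz.
    rewrite mxE zN zab => -[_ <-].
    by rewrite [RHS]mxE [X in _ = X + _]mxE [X in _ = _ + X]mxE.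
  move=> v.
  have -> : a *m v = p *: (a *m (N *m v)) - q *: (b *m (N *m v)).
    by rewrite [in LHS]aE mulmxBl -!scalemxAl !mulmxA.
  have -> : b *m v = p *: (b *m (N *m v)) + q *: (a *m (N *m v)).
    by rewrite [in LHS]bE mulmxDl -!scalemxAl !mulmxA.
  move: (a *m _) (b *m _) => s t.
  by rewrite !mxE; ring.
Qed.

End antistable.

Section mx_cvg.
Context {R : realType}.

Definition mx_cvg p q (X : nat -> 'M[R]_(p, q)) (L : 'M[R]_(p, q)) : Prop :=
  forall i j, X k i j @[k --> \oo] --> L i j.

Lemma mx_cvg_cst p q (M : 'M[R]_(p, q)) : mx_cvg (fun=> M) M.
Proof. by move=> i j; exact: cvg_cst. Qed.

Lemma mx_cvgD p q (X Y : nat -> 'M[R]_(p, q)) L M :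
  mx_cvg X L -> mx_cvg Y M -> mx_cvg (fun k => X k + Y k) (L + M).
Proof.
move=> XL YM i j; rewrite mxE; under eq_fun do rewrite mxE.
exact: cvgD.
Qed.

Lemma mx_cvgZ p q a (X : nat -> 'M[R]_(p, q)) L :
  mx_cvg X L -> mx_cvg (fun k => a *: X k) (a *: L).
Proof.
move=> XL i j; rewrite mxE; under eq_fun do rewrite mxE.
by apply: cvgM => //; exact: cvg_cst.
Qed.

Lemma mx_cvgN p q (X : nat -> 'M[R]_(p, q)) L :
  mx_cvg X L -> mx_cvg (fun k => - X k) (- L).
Proof.
move=> XL; rewrite -scaleN1r; under eq_fun do rewrite -scaleN1r.
exact: mx_cvgZ.
Qed.

Lemma mx_cvgT p q (X : nat -> 'M[R]_(p, q)) L :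
  mx_cvg X L -> mx_cvg (fun k => (X k)^T) L^T.
Proof. by move=> XL i j; rewrite mxE; under eq_fun do rewrite mxE; exact: XL. Qed.

Lemma cvg_finsum (I : finType) (P : pred I) (f : I -> nat -> R) (l : I -> R) :
  (forall i, f i k @[k --> \oo] --> l i) ->
  \sum_(i | P i) f i k @[k --> \oo] --> \sum_(i | P i) l i.
Proof. by move=> fl; apply: cvg_big => //; exact: add_continuous. Qed.

Lemma cvg_finprod (I : finType) (P : pred I) (f : I -> nat -> R) (l : I -> R) :
  (forall i, f i k @[k --> \oo] --> l i) ->
  \prod_(i | P i) f i k @[k --> \oo] --> \prod_(i | P i) l i.
Proof. by move=> fl; apply: cvg_big => //; exact: mul_continuous. Qed.

Lemma mx_cvgM p q s (X : nat -> 'M[R]_(p, q)) (Y : nat -> 'M[R]_(q, s)) L M :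
  mx_cvg X L -> mx_cvg Y M -> mx_cvg (fun k => X k *m Y k) (L *m M).
Proof.
move=> XL YM i j; rewrite mxE; under eq_fun do rewrite mxE.
by apply: cvg_finsum => l; exact: cvgM.
Qed.

Lemma mx_cvg_det n (X : nat -> 'M[R]_n) L :
  mx_cvg X L -> \det (X k) @[k --> \oo] --> \det L.
Proof.
move=> XL; apply: cvg_finsum => s; apply: cvgM; first exact: cvg_cst.
by apply: cvg_finprod => i; exact: XL.
Qed.

(** Each entry of the inverse is a cofactor over the determinant. Invertibility is asked at every
    index for this formula to apply, since [invmx] of a singular matrix is that matrix itself. *)
Lemma mx_cvg_inv n (X : nat -> 'M[R]_n) L :
  (forall k, X k \in unitmx) -> L \in unitmx ->
  mx_cvg X L -> mx_cvg (fun k => invmx (X k)) (invmx L).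
Proof.
move=> uX uL XL i j; rewrite /invmx uL mxE; under eq_fun do rewrite uX mxE.
apply: cvgM.
  apply: cvgV; last exact: mx_cvg_det.
  by rewrite -unitfE -unitmxE.
rewrite mxE; under eq_fun do rewrite mxE.
apply: cvgM; first exact: cvg_cst.
apply: mx_cvg_det => i' j'; rewrite !mxE; under eq_fun do rewrite !mxE.
exact: XL.
Qed.

Lemma mx_cvg_qf n (X : nat -> 'M[R]_n) L : mx_cvg X L -> forall v,
  quadratic_form (X k) v @[k --> \oo] --> quadratic_form L v.
Proof.
move=> XL v; apply: mx_cvgM; last exact: mx_cvg_cst.
by apply: mx_cvgM => //; exact: mx_cvg_cst.
Qed.

Lemma mx_cvg_unique p q (X : nat -> 'M[R]_(p, q)) L M :
  mx_cvg X L -> mx_cvg X M -> L = M.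
Proof.
by move=> XL XM; apply/matrixP => i j; apply: cvg_unique (XL i j) (XM i j).
Qed.

(* By polarization, convergence of the quadratic forms gives that of the
   entries. *)
Lemma mx_cvg_monotone n (X : nat -> 'M[R]_n) (S : 'M[R]_n) :
  (forall k, (X k)^T = X k) ->
  (forall k v, quadratic_form (X k) v <= quadratic_form (X k.+1) v) ->
  (forall k v, quadratic_form (X k) v <= quadratic_form S v) ->
  exists L, mx_cvg X L.
Proof.
move=> symX Xnd XS.
pose l v : R := limn (fun k => quadratic_form (X k) v).
have Xl v : quadratic_form (X k) v @[k --> \oo] --> l v.
  apply: nondecreasing_is_cvgn.
    by apply/nondecreasing_seqP => k; exact: Xnd.
  by exists (quadratic_form S v) => _ [k _ <-]; exact: XS.
pose e i : 'cV[R]_n := delta_mx i 0.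
exists (\matrix_(i, j) (2^-1 * (l (e i + e j) - l (e i) - l (e j)))) => i j.
rewrite mxE.
have -> : (fun k => X k i j) = fun k => 2^-1 * (quadratic_form (X k) (e i + e j)
    - quadratic_form (X k) (e i) - quadratic_form (X k) (e j)).
  by apply/funext => k; rewrite -qf_polar // mulKf.
apply: cvgM; first exact: cvg_cst.
by apply: cvgB; first exact: cvgB.
Qed.

End mx_cvg.

(** * The risk-sensitive Riccati operator *)

Section riccati.
Context {R : realType} {m d : nat}.
Variables (A : 'M[R]_m) (B : 'M[R]_(m, d)) (Q W : 'M[R]_m) (Ru : 'M[R]_d).
Variable beta : R.
Hypotheses (pQ : posdef Q) (pR : posdef Ru) (pW : posdef W) (beta0 : 0 < beta).

Definition robust_gap (X : 'M[R]_m) : 'M[R]_m := invmx W - beta *: X.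

(** The weight left after the noise has been maximized out under the penalty
    [beta^-1 * quadratic_form (invmx W) w]. *)
Definition tilde (X : 'M[R]_m) : 'M[R]_m :=
  X + beta *: (X *m invmx (robust_gap X) *m X).

Definition worst_noise (X : 'M[R]_m) : 'M[R]_m :=
  beta *: (invmx (robust_gap X) *m X).

Definition gain (X : 'M[R]_m) : 'M[R]_(d, m) :=
  invmx (Ru + B^T *m tilde X *m B) *m B^T *m tilde X *m A.

Definition riccati (X : 'M[R]_m) : 'M[R]_m :=
  Q + (gain X)^T *m Ru *m gain X
    + (A - B *m gain X)^T *m tilde X *m (A - B *m gain X).

(** The state map under the gain of [X] and the worst-case noise. By [worst_noise_inv] it is the
    matrix whose spectral radius defines a stabilizing solution. *)
Definition closed_loop (X : 'M[R]_m) : 'M[R]_m :=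
  (1%:M + worst_noise X) *m (A - B *m gain X).

Definition admissible (X : 'M[R]_m) : Prop :=
  [/\ X^T = X, forall v, 0 <= quadratic_form X v & posdef (robust_gap X)].

Lemma admissible0 : admissible 0.
Proof.
split; first by rewrite trmx0.
  by move=> v; rewrite qf0l.
by rewrite /robust_gap scaler0 subr0; exact: posdef_inv.
Qed.

(** The gap is antitone: that of [X] exceeds that of [Y] by [beta *: (Y - X)], so positive
    definiteness passes down. *)
Lemma admissible_le X Y : X^T = X -> (forall v, 0 <= quadratic_form X v) ->
  (forall v, quadratic_form X v <= quadratic_form Y v) -> admissible Y ->
  admissible X.
Proof.
move=> symX X0 XY [symY _ pG]; split => //.
have -> : robust_gap X = robust_gap Y + beta *: (Y - X).
  by rewrite /robust_gap scalerBr addrA subrK.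
apply: posdefD => //; first by rewrite linearZ linearB /= symX symY.
by move=> v; rewrite qfZl qfDl qfNl mulr_ge0 ?(ltW beta0) // subr_ge0.
Qed.

Lemma tilde_sym X : admissible X -> (tilde X)^T = tilde X.
Proof.
case=> symX _ [symG _].
by rewrite /tilde linearD linearZ /= !trmx_mul trmx_inv symG symX mulmxA.
Qed.

(* [worst_noise X *m y] maximizes the right-hand side over [w]. *)
Lemma tilde_max X y w : admissible X ->
  quadratic_form (tilde X) y =
  quadratic_form X (y + w) - beta^-1 * quadratic_form (invmx W) w
  + beta^-1 * quadratic_form (robust_gap X) (w - worst_noise X *m y).
Proof.
case=> symX X0 pG; have [symG _] := pG; have uG := posdef_unit pG.
have b0 : beta != 0 by rewrite gt_eqF.
have eI : invmx W = robust_gap X + beta *: X by rewrite /robust_gap subrK.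
have eG : robust_gap X *m (worst_noise X *m y) = beta *: (X *m y).
  by rewrite /worst_noise -scalemxAl -scalemxAr -mulmxA mulKVmx.
have -> : quadratic_form (tilde X) y = quadratic_form X y
    + beta * quadratic_form (X *m invmx (robust_gap X) *m X) y.
  by rewrite /tilde qfDl qfZl.
have -> : quadratic_form (invmx W) w =
    quadratic_form (robust_gap X) w + beta * quadratic_form X w.
  by rewrite {1}eI (qfDl (robust_gap X)) qfZl.
rewrite (qfD y w symX) (qfD w _ symG) mulmxN qfNr eG.
have -> : quadratic_form (X *m invmx (robust_gap X) *m X) y =
    beta^-2 * quadratic_form (robust_gap X) (worst_noise X *m y).
  rewrite [X in _ = _ * X]qfE eG /worst_noise -scalemxAl !dotE qfE.
  rewrite -!mulmxA [dot (_ *m _) _]dotC (dot_mull X) symX.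
  by field.
rewrite dotNr dotZr [dot w _]dotC dot_mull symX.
by field.
Qed.

Lemma tilde_ge X y w : admissible X ->
  quadratic_form X (y + w) - beta^-1 * quadratic_form (invmx W) w
    <= quadratic_form (tilde X) y.
Proof.
move=> aX; rewrite (tilde_max y w aX) lerDl mulr_ge0 ?invr_ge0 ?(ltW beta0) //.
by apply: posdef_ge0; case: aX.
Qed.

Lemma tilde_worst X y : admissible X ->
  quadratic_form (tilde X) y =
  quadratic_form X (y + worst_noise X *m y)
  - beta^-1 * quadratic_form (invmx W) (worst_noise X *m y).
Proof.
by move=> aX; rewrite (tilde_max y (worst_noise X *m y) aX) subrr qf0r mulr0 addr0.
Qed.

(** Both sides are maxima over the noise; the maximizer for [X] is a competitor for [Y]. *)
Lemma tilde_mono X Y y : admissible X -> admissible Y ->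
  (forall v, quadratic_form X v <= quadratic_form Y v) ->
  quadratic_form (tilde X) y <= quadratic_form (tilde Y) y.
Proof.
move=> aX aY XY; rewrite (tilde_worst y aX).
by apply: le_trans (tilde_ge y (worst_noise X *m y) aY); rewrite lerD2r.
Qed.

Lemma tilde_ge0 X y : admissible X -> 0 <= quadratic_form (tilde X) y.
Proof.
move=> aX; have := tilde_ge y 0 aX; rewrite addr0 qf0r mulr0 subr0.
by apply: le_trans; case: aX.
Qed.

Lemma posdef_input X : admissible X -> posdef (Ru + B^T *m tilde X *m B).
Proof.
move=> aX; apply: posdefD => //.
  by rewrite !trmx_mul trmxK tilde_sym // mulmxA.
by move=> v; rewrite qf_congr tilde_ge0.
Qed.

(** Stationarity of the one-stage cost in the control, at the minimizing gain. *)
Lemma gainE X : admissible X ->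
  Ru *m gain X = B^T *m tilde X *m (A - B *m gain X).
Proof.
move=> /posdef_input /posdef_unit uS.
have e : (Ru + B^T *m tilde X *m B) *m gain X = B^T *m tilde X *m A.
  by rewrite /gain; move: uS; set S := Ru + _ => uS; rewrite -!mulmxA mulKVmx.
by rewrite mulmxBr -e mulmxDl !mulmxA addrK.
Qed.

Lemma riccati_sym X : admissible X -> (riccati X)^T = riccati X.
Proof.
move=> aX; have [symQ _] := pQ; have [symR _] := pR.
rewrite /riccati [LHS](linearD (@trmx R m m)) [X in X + _](linearD (@trmx R m m)) /=.
rewrite (trmx_congr (S := Ru)) // (trmx_congr (S := tilde X)) ?tilde_sym //.
by rewrite symQ.
Qed.

(** By [gainE] the term in [Ru] cancels the contribution of [B *m gain X] to the left factor of the
    last term. *)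
Lemma riccatiE X : admissible X ->
  riccati X = Q + A^T *m tilde X *m (A - B *m gain X).
Proof.
move=> aX; have := gainE aX; rewrite /riccati -addrA.
move: (gain X) (tilde X) => K T hK; congr (_ + _).
rewrite -mulmxA hK mulmxA -mulmxA !mulmxA -!mulmxDl; congr (_ *m _ *m _).
by rewrite linearB /= trmx_mul addrC subrK.
Qed.

(** Completes the square in the control; stationarity of the gain removes the linear term. *)
Lemma riccati_min X x u : admissible X ->
  stage_cost Q Ru x u + quadratic_form (tilde X) (A *m x + B *m u) =
  quadratic_form (riccati X) x
  + quadratic_form (Ru + B^T *m tilde X *m B) (u + gain X *m x).
Proof.
move=> aX; have [symR _] := pR; have symT := tilde_sym aX.
have := gainE aX; rewrite /stage_cost /riccati.
move: (gain X) (tilde X) symT => K T symT hK.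
rewrite -[u](addrK (K *m x)) subrK; move: (u + K *m x) => v.
have -> : A *m x + B *m (v - K *m x) = (A - B *m K) *m x + B *m v.
  by rewrite mulmxBr mulmxBl mulmxA addrA addrAC.
rewrite !qfDl !qf_congr (qfD _ (B *m v)) // (qfD v) // qfNr mulmxN dotNr.
have -> : dot v (Ru *m (K *m x)) = dot ((A - B *m K) *m x) (T *m (B *m v)).
  by rewrite [RHS]dotC dot_mull symT [RHS]dot_mull !mulmxA -hK.
by ring.
Qed.

Lemma riccati_le X x u : admissible X ->
  quadratic_form (riccati X) x <=
  stage_cost Q Ru x u + quadratic_form (tilde X) (A *m x + B *m u).
Proof.
by move=> aX; rewrite riccati_min // lerDl; apply/posdef_ge0/posdef_input.
Qed.

Lemma riccati_gain X x : admissible X ->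
  quadratic_form (riccati X) x =
  stage_cost Q Ru x (- (gain X *m x))
  + quadratic_form (tilde X) ((A - B *m gain X) *m x).
Proof.
move=> aX; have := riccati_min x (- (gain X *m x)) aX.
rewrite addNr qf0r addr0 mulmxBl => <-.
by rewrite mulmxN mulmxA.
Qed.

(** The Riccati image is a minimum over the control of quantities monotone in the weight; the
    minimizer for [Y] is tried for [X]. *)
Lemma riccati_mono X Y : admissible X -> admissible Y ->
  (forall v, quadratic_form X v <= quadratic_form Y v) ->
  forall v, quadratic_form (riccati X) v <= quadratic_form (riccati Y) v.
Proof.
move=> aX aY XY v; rewrite [leRHS](riccati_gain v aY).
apply: (le_trans (riccati_le v (- (gain Y *m v)) aX)).
by rewrite mulmxN mulmxA mulmxBl lerD2l tilde_mono.
Qed.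

Lemma riccati_geQ X v : admissible X -> quadratic_form Q v <= quadratic_form (riccati X) v.
Proof.
move=> aX; rewrite riccati_gain // /stage_cost -addrA lerDl addr_ge0 //.
  exact: posdef_ge0.
exact: tilde_ge0.
Qed.

Lemma closed_loopE X : admissible X ->
  X *m closed_loop X = tilde X *m (A - B *m gain X).
Proof.
move=> aX; rewrite /closed_loop mulmxA; congr (_ *m _).
by rewrite mulmxDr mulmx1 /worst_noise -scalemxAr mulmxA.
Qed.

(* First-order optimality conditions: the state dynamics along the saddle
   point, with co-state [X *m closed_loop X]. *)
Lemma closed_loop_dynamics X : admissible X ->
  closed_loop X =
  A - B *m gain X + beta *: (W *m (X *m closed_loop X)).
Proof.
move=> aX; have [symX X0 pG] := aX; have uG := posdef_unit pG.
have uW := posdef_unit pW.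
rewrite {1}/closed_loop mulmxDl mul1mx; congr (_ + _).
rewrite /worst_noise -scalemxAl; congr (_ *: _).
rewrite closed_loopE // /tilde.
have -> : X + beta *: (X *m invmx (robust_gap X) *m X) =
   invmx W *m (invmx (robust_gap X) *m X).
  have -> : invmx W = robust_gap X + beta *: X by rewrite /robust_gap subrK.
  by rewrite mulmxDl mulKVmx // -scalemxAl mulmxA.
by rewrite !mulmxA mulmxV // mul1mx.
Qed.

(** With [F], [N] the closed loops of [X] and [Y], the product [F^T *m X *m N] is expanded by the
    dynamics of [N], and [F^T *m Y *m N] by those of [F]. The terms in [Ru], [W] and [Q] coincide
    and cancel in the difference. *)
Lemma fixed_point_difference X Y : admissible X -> admissible Y ->
  riccati X = X -> riccati Y = Y ->
  X - Y = (closed_loop X)^T *m (X - Y) *m closed_loop Y.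
Proof.
move=> aX aY fX fY.
have [symX _ _] := aX; have [symY _ _] := aY.
have [symR _] := pR; have [symW _] := pW; have [symQ _] := pQ.
have dX := closed_loop_dynamics aX; have dY := closed_loop_dynamics aY.
have rX := gainE aX; rewrite -mulmxA -closed_loopE // in rX.
have rY := gainE aY; rewrite -mulmxA -closed_loopE // in rY.
have qX := riccatiE aX; rewrite -mulmxA -closed_loopE // fX in qX.
have qY := riccatiE aY; rewrite -mulmxA -closed_loopE // fY in qY.
move: (closed_loop X) (closed_loop Y) (gain X) (gain Y) dX dY rX rY qX qY.
move=> F N K L dX dY rX rY qX qY.
have qX' : F^T *m X *m A = X - Q.
  have -> : X - Q = (X - Q)^T by rewrite linearB /= symX symQ.
  by rewrite {2}qX addrC addKr !trmx_mul trmxK symX.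
have rX' : F^T *m X *m B = K^T *m Ru.
  by rewrite -[RHS]trmxK trmx_mul trmxK symR rX !trmx_mul trmxK symX.
have FXN : F^T *m X *m N =
    (X - Q) - K^T *m Ru *m L + beta *: (F^T *m X *m W *m Y *m N).
  by rewrite {1}dY mulmxDr mulmxBr qX' (mulmxA _ B L) rX' -scalemxAr !mulmxA.
have FYN : F^T *m Y *m N =
    (Y - Q) - K^T *m Ru *m L + beta *: (F^T *m X *m W *m Y *m N).
  rewrite {1}dX linearD linearB linearZ /= !trmx_mul symX symW.
  have -> : Y - Q = A^T *m (Y *m N) by rewrite {1}qY addrC addKr.
  by rewrite !mulmxDl !mulNmx -!scalemxAl -!mulmxA -rY.
rewrite mulmxBr mulmxBl FXN FYN; move: (_ *m L) (_ *: _) => U V.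
by apply/matrixP => i j; rewrite !mxE; ring.
Qed.

Lemma tilde_cvg (Y : nat -> 'M[R]_m) L : (forall k, admissible (Y k)) ->
  admissible L -> mx_cvg Y L -> mx_cvg (fun k => tilde (Y k)) (tilde L).
Proof.
move=> aY aL YL; apply: mx_cvgD => //; apply: mx_cvgZ.
apply: mx_cvgM => //; apply: mx_cvgM => //; apply: mx_cvg_inv.
- by move=> k; apply: posdef_unit; case: (aY k).
- by apply: posdef_unit; case: aL.
- by apply: mx_cvgD; [exact: mx_cvg_cst|apply/mx_cvgN/mx_cvgZ].
Qed.

Lemma gain_cvg (Y : nat -> 'M[R]_m) L : (forall k, admissible (Y k)) ->
  admissible L -> mx_cvg Y L -> mx_cvg (fun k => gain (Y k)) (gain L).
Proof.
move=> aY aL YL; have tL := tilde_cvg aY aL YL.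
apply: mx_cvgM; last exact: mx_cvg_cst.
apply: mx_cvgM => //; apply: mx_cvgM; last exact: mx_cvg_cst.
apply: mx_cvg_inv.
- by move=> k; apply/posdef_unit/posdef_input.
- exact/posdef_unit/posdef_input.
- apply: mx_cvgD; first exact: mx_cvg_cst.
  apply: mx_cvgM; last exact: mx_cvg_cst.
  by apply: mx_cvgM => //; exact: mx_cvg_cst.
Qed.

Lemma riccati_admissible X Z : admissible X -> admissible Z ->
  (forall v, quadratic_form X v <= quadratic_form Z v) ->
  (forall v, quadratic_form (riccati Z) v <= quadratic_form Z v) ->
  admissible (riccati X).
Proof.
move=> aX aZ XZ fZ; apply: (admissible_le _ _ _ aZ).
- exact: riccati_sym.
- move=> v; apply: (le_trans _ (riccati_geQ v aX)).
  exact: posdef_ge0.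
- by move=> v; apply: le_trans (fZ v); apply: riccati_mono.
Qed.

(** * Value iteration and its limit *)

Definition value_iteration k : 'M[R]_m := iter k riccati 0.

(** A supersolution stays above the iterates by monotonicity, and being dominated by it keeps them
    admissible, so that the induction can go on. *)
Lemma value_iteration_le Z : admissible Z ->
  (forall v, quadratic_form (riccati Z) v <= quadratic_form Z v) ->
  forall k, admissible (value_iteration k) /\
    forall v, quadratic_form (value_iteration k) v <= quadratic_form Z v.
Proof.
move=> aZ fZ; elim=> [|k [aY YZ]] /=.
  split; first exact: admissible0.
  by move=> v; rewrite qf0l; case: aZ.
split; first exact: riccati_admissible aZ YZ fZ.
by move=> v; apply: le_trans (fZ v); apply: riccati_mono.
Qed.

(* The quadratic form [|z v|^2], [z = a + i b], expands along [closed_loop Y] by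
   the factor [1 / r > 1]; this strict gain absorbs the change of the maximizing
   noise when a small multiple of the form is subtracted from [Y]. *)
Lemma riccati_supersolution Y (r : R) (a b : 'rV[R]_m) :
  admissible Y -> riccati Y = Y -> 0 <= r < 1 ->
  (forall v : 'cV[R]_m, ((a *m v) 0 0) ^+ 2 + ((b *m v) 0 0) ^+ 2 =
    r * (((a *m (closed_loop Y *m v)) 0 0) ^+ 2
         + ((b *m (closed_loop Y *m v)) 0 0) ^+ 2)) ->
  exists2 eps : R, 0 < eps & exists Z, [/\ admissible Z,
    forall v, quadratic_form (riccati Z) v <= quadratic_form Z v &
    forall v, quadratic_form Z v = quadratic_form Y v
      - eps * (((a *m v) 0 0) ^+ 2 + ((b *m v) 0 0) ^+ 2)].
Proof.
move=> aY fY /andP[r0 r1].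
pose g (v : 'cV[R]_m) : R := ((a *m v) 0 0) ^+ 2 + ((b *m v) 0 0) ^+ 2.
rewrite -[X in X -> _]/(forall v, g v = r * g (closed_loop Y *m v)) => gN.
have [symY Y0 pG] := aY.
(* A fixed point dominates [Q], hence is definite; this lets a multiple of [Y] bound [g]. *)
have pY : posdef Y.
  split => // v v0; rewrite -fY.
  by apply: lt_le_trans (riccati_geQ v aY); case: pQ => _; apply.
have bound (S : 'M[R]_m) : posdef S ->
    exists2 C : R, 0 <= C & forall v, g v <= C * quadratic_form S v.
  move=> pS; have [C1 C10 h1] := posdef_bound a pS.
  have [C2 C20 h2] := posdef_bound b pS.
  exists (C1 + C2); first exact: addr_ge0.
  by move=> v; rewrite mulrDl lerD.
have [C1 C10 gG] := bound _ pG.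
have [C2 C20 gY] := bound _ pY.
(* The least constant such that [r * x ^+ 2 <= (x + t) ^+ 2 + s * t ^+ 2] for all [x] and [t]. *)
pose s := r / (1 - r).
have s0 : 0 <= s by rewrite divr_ge0 // subr_ge0 ltW.
(* Small enough for two purposes: [eps * C2 <= 1] keeps the perturbed matrix nonnegative, and
   [eps * s * C1 <= beta^-1] lets the gap term absorb the change of noise. *)
pose eps := (1 + C2 + beta * s * C1)^-1.
have E0 : 0 <= beta * s * C1 := mulr_ge0 (mulr_ge0 (ltW beta0) s0) C10.
have D0 : 0 < 1 + C2 + beta * s * C1 by lra.
have eps0 : 0 < eps by rewrite invr_gt0.
have epsC2 : eps * C2 <= 1.
  by rewrite /eps mulrC ler_pdivrMr // mul1r; lra.
have epsC1 : eps * s * C1 <= beta^-1.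
  have -> : eps * s * C1 = beta * s * C1 / (1 + C2 + beta * s * C1) / beta.
    by rewrite /eps; field; rewrite !gt_eqF.
  by rewrite ler_pdivrMr // mulVf ?gt_eqF // ler_pdivrMr // mul1r; lra.
pose H := a^T *m a + b^T *m b.
have qH v : quadratic_form H v = g v.
  have sq (c : 'rV[R]_m) : quadratic_form (c^T *m c) v = ((c *m v) 0 0) ^+ 2.
    by rewrite -[c^T]mulmx1 qf_congr qfE mul1mx /dot mxE big_ord1 mxE expr2.
  by rewrite /H qfDl !sq.
have qZ v : quadratic_form (Y - eps *: H) v = quadratic_form Y v - eps * g v.
  by rewrite qfDl qfNl qfZl qH.
have g0 v : 0 <= g v by rewrite addr_ge0 ?sqr_ge0.
exists eps => //; exists (Y - eps *: H).
have aZ : admissible (Y - eps *: H).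
  apply: (admissible_le _ _ _ aY) => //.
  - by rewrite linearB linearZ linearD /= !trmx_mul !trmxK symY.
  - move=> v; rewrite qZ subr_ge0; apply: (le_trans (ler_wpM2l (ltW eps0) (gY v))).
    by rewrite mulrA ler_piMl.
  - by move=> v; rewrite qZ lerBlDr lerDl mulr_ge0 // ltW.
split => // v.
(* The gain of [Y] is only a candidate control for the perturbed matrix, which suffices for an upper
   bound of its Riccati image. *)
apply: (le_trans (riccati_le v (- (gain Y *m v)) aZ)).
rewrite mulmxN mulmxA -mulmxBl.
have := riccati_gain v aY; rewrite fY => eY; rewrite [leRHS]qZ eY.
set y := (A - _) *m v; rewrite (tilde_worst y aZ).
(* [w] is the worst noise for the perturbed matrix; its deviation [dl] from the worst noise for [Y]
   carries the gap penalty given by [tilde_max]. *)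
set w := worst_noise (Y - eps *: H) *m y.
rewrite (tilde_max y w aY) qZ; set dl := w - worst_noise Y *m y.
have -> : y + w = closed_loop Y *m v + dl.
  by rewrite /closed_loop -mulmxA -/y mulmxDl mul1mx /dl addrACA subrr addr0.
have gD (p q : 'cV[R]_m) : r * g p <= g (p + q) + s * g q.
  have sqD (x t : R) : r * x ^+ 2 <= (x + t) ^+ 2 + s * t ^+ 2.
    rewrite -subr_ge0.
    have -> : (x + t) ^+ 2 + s * t ^+ 2 - r * x ^+ 2 =
        ((1 - r) * x + t) ^+ 2 / (1 - r).
      by rewrite /s; field; rewrite subr_eq0 gt_eqF.
    by rewrite divr_ge0 ?sqr_ge0 // subr_ge0 ltW.
  have := sqD ((a *m p) 0 0) ((a *m q) 0 0).
  have := sqD ((b *m p) 0 0) ((b *m q) 0 0).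
  by rewrite /g !mulmxDr !mxE; lra.
have := gD (closed_loop Y *m v) dl; rewrite -gN => h1.
have h2 := gG dl.
have : eps * g v <= eps * g (closed_loop Y *m v + dl)
    + beta^-1 * quadratic_form (robust_gap Y) dl.
  have := ler_wpM2l (ltW eps0) h1.
  have := ler_wpM2l (mulr_ge0 (ltW eps0) s0) h2.
  have := ler_wpM2r (posdef_ge0 dl pG) epsC1.
  by rewrite !mulrDr !mulrA; lra.
by lra.
Qed.

Variable P : 'M[R]_m.
Hypotheses (aP : admissible P) (fP : riccati P = P).
Hypothesis stable : spectral_radius (closed_loop P) < 1.

(* The monotone limit [L] is a fixed point below [P].  If [P - L] did not vanish,
   [closed_loop L] would be antistable along some rows, giving a supersolution
   strictly below [L], whereas supersolutions bound the value iteration. *)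
Lemma value_iteration_cvg : mx_cvg value_iteration P.
Proof.
have fP' v : quadratic_form (riccati P) v <= quadratic_form P v by rewrite fP.
have YP := value_iteration_le aP fP'.
have Ynd k v : quadratic_form (value_iteration k) v
    <= quadratic_form (value_iteration k.+1) v.
  elim: k v => [|k IH] v; first by rewrite qf0l; case: (YP 1%N) => -[].
  by apply: riccati_mono => //; [case: (YP k)|case: (YP k.+1)].
have [L YL] : exists L, mx_cvg value_iteration L.
  apply: (mx_cvg_monotone _ Ynd) => [k|k v]; first by case: (YP k) => -[].
  by case: (YP k).
have symL : L^T = L.
  apply: (mx_cvg_unique _ YL).
  have -> : value_iteration = (fun k => (value_iteration k)^T).
    by apply/funext => k; case: (YP k) => -[].
  exact: mx_cvgT.
have L_le Z : (forall k v, quadratic_form (value_iteration k) v <= quadratic_form Z v) ->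
    forall v, quadratic_form L v <= quadratic_form Z v.
  move=> YZ v; apply: (cvgr_to_le (mx_cvg_qf YL (v := v))).
  by apply: nearW => k; exact: YZ.
have L0 v : 0 <= quadratic_form L v.
  apply: (cvgr_to_ge (mx_cvg_qf YL (v := v))).
  by apply: nearW => k; case: (YP k) => -[].
have aL : admissible L.
  by apply: (admissible_le symL L0 _ aP) => //; apply: L_le => k; case: (YP k).
have aY k : admissible (value_iteration k) by case: (YP k).
have tL := tilde_cvg aY aL YL.
have gL := gain_cvg aY aL YL.
have fL : riccati L = L.
  apply: (mx_cvg_unique (X := fun k => value_iteration k.+1)); last first.
    by move=> i j; rewrite (cvg_shiftS (fun k => value_iteration k i j)); exact: YL.
  rewrite riccatiE //.
  have -> : (fun k => value_iteration k.+1) = fun k => Q + A^T *m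
      tilde (value_iteration k) *m (A - B *m gain (value_iteration k)).
    by apply/funext => k; rewrite /= riccatiE.
  apply: mx_cvgD; first exact: mx_cvg_cst.
  apply: mx_cvgM; first by apply: mx_cvgM => //; exact: mx_cvg_cst.
  apply: mx_cvgD; first exact: mx_cvg_cst.
  by apply: mx_cvgN; apply: mx_cvgM => //; exact: mx_cvg_cst.
have [->//|PL] := eqVneq P L.
have eD := fixed_point_difference aP aL fP fL.
have D0 : P - L != 0 by rewrite subr_eq0.
have [r [a [b [r01 ab gN]]]] := antistable_rows stable eD D0.
have [eps eps0 [Z [aZ fZ qZ]]] := riccati_supersolution aL fL r01 gN.
(* [Z] bounds the iterates and therefore [L], although it equals [L] minus [eps] times this sum of
   squares. *)
have {}gN (v : 'cV[R]_m) : ((a *m v) 0 0) ^+ 2 + ((b *m v) 0 0) ^+ 2 <= 0.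
  have := L_le Z (fun k => (value_iteration_le aZ fZ k).2) v.
  by rewrite qZ -subr_ge0 addrAC subrr add0r oppr_ge0 pmulr_rle0.
have row0 (c : 'rV[R]_m) : (c *m c^T) 0 0 = 0 -> c = 0.
  by move=> c0; apply: trmx_inj; rewrite trmx0; apply: dot_eq0; rewrite /dot trmxK.
have sq0 (x y : R) : x ^+ 2 + y ^+ 2 <= 0 -> x = 0 /\ y = 0.
  by move=> h; split; nra.
(* Testing on [a^T] and [b^T] makes one of the squared terms the square of a squared norm. *)
case: ab => /eqP[]; apply: row0.
  by have /sq0[] := gN a^T.
by have /sq0[] := gN b^T.
Qed.

End riccati.

(** * Measurability and independence *)

Section measurable_mx.
Context {dT : measure_display} {T : measurableType dT} {R : realType}.

Lemma measurable_coord p q (i : 'I_p) (j : 'I_q) :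
  measurable_fun [set: 'M[R]_(p, q)] (fun M : 'M[R]_(p, q) => M i j).
Proof.
move=> _ Y mY; rewrite setTI; apply: sub_sigma_algebra.
by exists i, j; exists Y.
Qed.

Lemma measurable_mx p q (f : T -> 'M[R]_(p, q)) :
  (forall i j, measurable_fun setT (fun x => f x i j)) -> measurable_fun setT f.
Proof.
move=> mf; apply: (@measurability _ _ T 'M[R]_(p, q) setT f (@matrix_cylinders _ R p q)).
  by [].
move=> _ [_ [i [j [C mC ->]] <-]].
exact: mf.
Qed.

Lemma measurable_entry p q (f : T -> 'M[R]_(p, q)) i j :
  measurable_fun setT f -> measurable_fun setT (fun x => f x i j).
Proof. by move=> mf; exact: (measurableT_comp (measurable_coord i j) mf). Qed.

Lemma measurable_addmx p q (f g : T -> 'M[R]_(p, q)) :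
  measurable_fun setT f -> measurable_fun setT g ->
  measurable_fun setT (fun x => f x + g x).
Proof.
move=> mf mg; apply: measurable_mx => i j; under eq_fun do rewrite mxE.
by apply: measurable_funD; exact: measurable_entry.
Qed.

Lemma measurable_mulmx p q s (f : T -> 'M[R]_(p, q)) (g : T -> 'M[R]_(q, s)) :
  measurable_fun setT f -> measurable_fun setT g ->
  measurable_fun setT (fun x => f x *m g x).
Proof.
move=> mf mg; apply: measurable_mx => i j; under eq_fun do rewrite mxE.
apply: measurable_sum => k.
by apply: measurable_funM; exact: measurable_entry.
Qed.

Lemma measurable_trmx p q (f : T -> 'M[R]_(p, q)) :
  measurable_fun setT f -> measurable_fun setT (fun x => (f x)^T).
Proof.
move=> mf; apply: measurable_mx => i j; under eq_fun do rewrite mxE.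
exact: measurable_entry.
Qed.

Lemma measurable_qf n (S : 'M[R]_n) (f : T -> 'cV[R]_n) :
  measurable_fun setT f -> measurable_fun setT (fun x => quadratic_form S (f x)).
Proof.
move=> mf; apply: measurable_entry; apply: measurable_mulmx => //.
by apply: measurable_mulmx => //; exact: measurable_trmx.
Qed.

Lemma measurable_dot n (f g : T -> 'cV[R]_n) :
  measurable_fun setT f -> measurable_fun setT g ->
  measurable_fun setT (fun x => dot (f x) (g x)).
Proof.
move=> mf mg; apply: measurable_entry; apply: measurable_mulmx => //.
exact: measurable_trmx.
Qed.

Lemma measurable_expR_EFin (f : T -> R) : measurable_fun setT f ->
  measurable_fun setT (fun x => (expR (f x))%:E).
Proof.
by move=> mf; apply/measurable_EFinP; apply: measurableT_comp mf; exact: measurable_expR.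
Qed.

End measurable_mx.

Section independence.
Context {dO : measure_display} {Omega : measurableType dO} {R : realType}.
Variable P : probability Omega R.
Context {I : choiceType} {dE : measure_display} {E : measurableType dE}.
Variable X : I -> Omega -> E.
Hypothesis mX : forall i, measurable_fun setT (X i).
Hypothesis indX : mutually_independent P X.

Local Open Scope ereal_scope.

Definition joint_event (J : {fset I}) (B : I -> set E) : set Omega :=
  \bigcap_(i in [set` J]) X i @^-1` B i.

(* [V] is independent of the family [X i], [i \notin S]. *)
Definition indep_off (S : {fset I}) {dT} {T : measurableType dT}
    (V : Omega -> T) : Prop :=
  measurable_fun setT V /\
  forall A (J : {fset I}) (B : I -> set E), measurable A ->
    (forall i, i \in J -> i \notin S) ->
    (forall i, i \in J -> measurable (B i)) ->
    P (V @^-1` A `&` joint_event J B) =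
      P (V @^-1` A) * \prod_(i <- J) P (X i @^-1` B i).

Lemma measurable_joint_event J B :
  (forall i, i \in J -> measurable (B i)) -> measurable (joint_event J B).
Proof.
move=> mB; apply: fin_bigcap_measurable => // i iJ.
by rewrite -[X in measurable X]setTI; apply: mX => //; exact: mB.
Qed.

Lemma indep_off_cst {dT} {T : measurableType dT} (c : T) :
  indep_off fset0 (fun=> c).
Proof.
split => // A J B mA _ mB; rewrite -indX //; have [Ac|Ac] := pselect (A c).
  have -> : (fun=> c) @^-1` A = [set: Omega] by apply/seteqP; split.
  by rewrite setTI probability_setT mul1e.
have -> : (fun=> c) @^-1` A = set0 :> set Omega by apply/seteqP; split.
by rewrite set0I measure0 mul0e.
Qed.

Lemma indep_off_comp S {dT dT'} {T : measurableType dT} {T' : measurableType dT'}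
    (V : Omega -> T) (g : T -> T') :
  measurable_fun setT g -> indep_off S V -> indep_off S (g \o V).
Proof.
move=> mg [mV iV]; split; first exact: measurableT_comp.
move=> A J B mA; apply: (iV (g @^-1` A)).
by rewrite -[X in measurable X]setTI; exact: mg.
Qed.

Lemma joint_event1 i B : joint_event [fset i]%fset B = X i @^-1` B i.
Proof. by rewrite /joint_event set_fset1 bigcap_set1. Qed.

Lemma indep_off1 S {dT} {T : measurableType dT} (V : Omega -> T) i A D :
  indep_off S V -> i \notin S -> measurable A -> measurable D ->
  P (V @^-1` A `&` X i @^-1` D) = P (V @^-1` A) * P (X i @^-1` D).
Proof.
move=> [_ iV] iS mA mD; rewrite -(joint_event1 i (fun=> D)) iV //.
- by rewrite big_seq_fset1 joint_event1.
- by move=> j /[!inE] /eqP ->.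
Qed.

Let G {dT} {T : measurableType dT} : set (set (T * E)) :=
  [set A `*` D | A in measurable & D in measurable].

(** Both sides are finite measures in the event [D]; they agree on rectangles, which form a
    generating pi-system, hence everywhere. *)
Lemma indep_off_pair S {dT} {T : measurableType dT} (V : Omega -> T) i :
  indep_off S V -> i \notin S ->
  indep_off (i |` S)%fset (fun omega => (V omega, X i omega)).
Proof.
move=> iV iS; have [mV hV] := iV.
have mVX : measurable_fun setT (fun omega => (V omega, X i omega)).
  exact: measurable_fun_pair.
split => // D J B mD JS mB.
have mC := measurable_joint_event mB.
have iJ : i \notin J by apply/negP => /JS; rewrite !inE eqxx.
have JS' j : j \in J -> j \notin S.
  by move=> /JS; rewrite !inE negb_or => /andP[].
have PC : P (joint_event J B) = \prod_(j <- J) P (X j @^-1` B j).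
  have := hV setT J B measurableT JS' mB.
  by rewrite preimage_setT setTI probability_setT mul1e.
have PCfin : P (joint_event J B) \is a fin_num by exact: fin_num_measure.
have c0 : (0 <= fine (P (joint_event J B)))%R by rewrite fine_ge0.
pose VX omega := (V omega, X i omega).
pose m1 : {measure set (T * E) -> \bar R} := pushforward (mrestr P mC) VX.
pose m2 : {measure set (T * E) -> \bar R} := mscale (NngNum c0) (pushforward P VX).
rewrite -PC -[LHS]/(m1 mVX D) muleC -(fineK PCfin) -[RHS]/(m2 mVX D).
apply: (measure_unique (G (T := T)) (fun=> setT) _ _ _ _ (m1 mVX) (m2 mVX)) => //.
- by rewrite measurable_prod_measurableType.
- move=> _ _ [A1 mA1 [B1 mB1 <-]] [A2 mA2 [B2 mB2 <-]].
  rewrite -setXI; exists (A1 `&` A2); first exact: measurableI.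
  by exists (B1 `&` B2) => //; exact: measurableI.
- move=> _; exists setT => //; exists setT => //.
  by rewrite setXTT.
- by rewrite bigcup_const.
- move=> _ [A mA [D1 mD1 <-]].
  rewrite -[LHS]/(P ((V @^-1` A `&` X i @^-1` D1) `&` joint_event J B)).
  rewrite -[RHS]/((fine (P (joint_event J B)))%:E * P (V @^-1` A `&` X i @^-1` D1)).
  rewrite fineK // (indep_off1 iV iS mA mD1) PC.
  (* On a rectangle the constraint on [X i] becomes one more component of the joint event, to which
     the independence of [V] applies. *)
  pose B' j := if j == i then D1 else B j.
  have -> : V @^-1` A `&` X i @^-1` D1 `&` joint_event J B =
      V @^-1` A `&` joint_event (i |` J)%fset B'.
    rewrite /joint_event bigcap_fsetU1 {1}/B' eqxx -setIA; congr (_ `&` (_ `&` _)).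
    apply: eq_bigcapr => j /= jJ; rewrite /B'; case: eqP => // ji.
    by rewrite -ji jJ in iJ.
  rewrite hV //.
  + rewrite big_fsetU1 //= {1}/B' eqxx.
    have -> : \prod_(j <- J) P (X j @^-1` B' j) = \prod_(j <- J) P (X j @^-1` B j).
      apply: eq_big_seq => j jJ; rewrite /B'; case: eqP => // ji.
      by rewrite -ji jJ in iJ.
    by rewrite [RHS]muleC muleA.
  + by move=> j; rewrite !inE => /orP[/eqP -> //|/JS'].
  + move=> j; rewrite !inE /B'; case: eqP => //= _; exact: mB.
- move=> _; rewrite -[X in X < _]/(P (setT `&` joint_event J B)) setTI.
  by rewrite ltey_eq PCfin.
Qed.

(** The joint law of [V] and [X i] is the product of their laws, so Tonelli integrates out [X i]
    with [V] frozen. *)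
Lemma indep_off_integral S {dT} {T : measurableType dT} (V : Omega -> T) i
    (f : T * E -> \bar R) :
  indep_off S V -> i \notin S -> measurable_fun setT f -> (forall x, 0 <= f x) ->
  \int[P]_omega f (V omega, X i omega) =
    \int[P]_omega \int[P]_omega' f (V omega, X i omega').
Proof.
move=> iV iS mf f0; have [mV _] := iV.
have mVX : measurable_fun setT (fun omega => (V omega, X i omega)).
  exact: measurable_fun_pair.
pose VX : {RV P >-> (T * E)%type} :=
  HB.pack (fun omega => (V omega, X i omega)) (isMeasurableFun.Build _ _ _ _ _ mVX).
pose V' : {RV P >-> T} := HB.pack V (isMeasurableFun.Build _ _ _ _ _ mV).
pose X' : {RV P >-> E} := HB.pack (X i) (isMeasurableFun.Build _ _ _ _ _ (mX i)).
rewrite -[LHS]/(\int[P]_omega (f \o VX) omega) -(ge0_integral_distribution VX mf f0).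
rewrite (eq_measure_integral (distribution P V' \x distribution P X')); last first.
  move=> D mD _; apply/esym/product_measure_unique => // A B mA mB.
  exact: indep_off1 iV iS mA mB.
rewrite fubini_tonelli1 //.
rewrite ge0_integral_distribution; last 2 first.
- exact: measurable_fun_fubini_tonelli_F.
- by move=> x; exact: integral_ge0.
apply: eq_integral => omega _ /=.
rewrite /fubini_F ge0_integral_distribution //.
by apply: (measurableT_comp mf); exact: measurable_fun_pair.
Qed.

End independence.

(** * Gaussian integrals *)

Section gaussian_integral.
Context {R : realType}.
Local Open Scope ereal_scope.
Local Notation mu := (@lebesgue_measure R).

(** The Radon-Nikodym derivative of [normal_prob] equals [normal_pdf] almost everywhere, since both
    have the same integral over every measurable set. *)
Lemma ge0_integral_normal_prob (c s : R) (f : R -> \bar R) :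
  measurable_fun setT f -> (forall x, 0 <= f x) -> s != 0%R ->
  \int[normal_prob c s]_x f x = \int[mu]_x (f x * (normal_pdf c s x)%:E).
Proof.
move=> mf f0 s0.
have dom : normal_prob c s `<< mu by exact: normal_prob_dominates.
rewrite -(Radon_Nikodym_SigmaFinite.change_of_variables dom f0 measurableT mf).
have ig := Radon_Nikodym_SigmaFinite.f_integrable dom.
have mpdf : measurable_fun setT (fun x => (normal_pdf c s x)%:E).
  by apply/measurable_EFinP; exact: measurable_normal_pdf.
apply: ae_eq_integral => //.
- by apply: emeasurable_funM => //; exact: measurable_int ig.
- exact: emeasurable_funM.
- apply: ae_eqe_mul2l; apply: integral_ae_eq => //.
  by move=> D _ mD; rewrite -Radon_Nikodym_SigmaFinite.f_integral.
Qed.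

Lemma measurable_exp_quadratic (p q : R) :
  measurable_fun setT (fun z : R => (expR (p * z ^+ 2 + q * z))%:E).
Proof.
apply: measurable_expR_EFin; apply: measurable_funD.
  by apply: measurable_funM => //; exact: measurable_funX.
exact: measurable_funM.
Qed.

(* Completing the square turns the integrand into a multiple of the density of
   [N(b / a, 1 / a)]. *)
Lemma integral_normal_exp (a b : R) : (0 < a)%R ->
  \int[normal_prob 0 1]_z (expR (- (2^-1) * (a - 1) * z ^+ 2 + b * z))%:E =
  ((Num.sqrt a)^-1 * expR (2^-1 * (b ^+ 2 / a)))%:E.
Proof.
move=> a0; have sa0 : (0 < Num.sqrt a)%R by rewrite sqrtr_gt0.
have mexp := measurable_exp_quadratic (- (2^-1) * (a - 1))%R b.
rewrite ge0_integral_normal_prob //.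
set k : R := ((Num.sqrt a)^-1 * expR (2^-1 * (b ^+ 2 / a)))%R.
have k0 : (0 <= k)%R by rewrite mulr_ge0 ?expR_ge0 // invr_ge0 ltW.
pose s := ((Num.sqrt a)^-1)%R.
have s0 : s != 0%R by rewrite invr_eq0 gt_eqF.
have key (z : R) : (expR (- 2^-1 * (a - 1) * z ^+ 2 + b * z) * normal_pdf 0 1 z
    = k * normal_pdf (b / a) s z)%R.
  rewrite !normal_pdfE // ?oner_eq0 // /normal_fun /normal_peak.
  have s2 : (s ^+ 2 = a^-1)%R by rewrite /s exprVn sqr_sqrtr // ltW.
  have -> : Num.sqrt (s ^+ 2 * pi *+ 2) = (s * Num.sqrt (1 ^+ 2 * pi *+ 2))%R.
    rewrite expr1n mul1r -mulrnAr sqrtrM ?sqr_ge0 // sqrtr_sqr ger0_norm //.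
    by rewrite /s invr_ge0 ltW.
  rewrite /k -/s invfM s2 subr0 expr1n -[in LHS]mulr_natr mul1r -(mulr_natr a^-1).
  set q := ((Num.sqrt _)^-1)%R.
  transitivity (q * expR (- 2^-1 * (a - 1) * z ^+ 2 + b * z - z ^+ 2 / 2%:R))%R.
    by rewrite [in RHS]expRD -(mulNr (z ^+ 2)%R); ring.
  transitivity (q * expR (2^-1 * (b ^+ 2 / a) - (z - b / a) ^+ 2 / (a^-1 * 2%:R)))%R.
    by congr (_ * expR _)%R; field; rewrite gt_eqF.
  by rewrite [in LHS]expRD -(mulNr ((z - b / a) ^+ 2)%R); field.
under eq_integral do rewrite -EFinM key EFinM.
rewrite ge0_integralZl //=.
- by rewrite integral_normal_pdf mule1.
- by apply/measurable_EFinP; exact: measurable_normal_pdf.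
- by move=> z _; rewrite lee_fin normal_pdf_ge0.
Qed.

End gaussian_integral.

Section gaussian_vector.
Context {dO : measure_display} {Omega : measurableType dO} {R : realType}.
Variable P : probability Omega R.
Context {I : choiceType}.
Variable Z : I -> {RV P >-> R}.
Hypothesis indZ : mutually_independent P (fun i => Z i : Omega -> R).
Hypothesis normZ : forall i, standard_normal (Z i).

Local Open Scope ereal_scope.

Let mZ i : measurable_fun setT (Z i : Omega -> R).
Proof. exact: measurable_funPT. Qed.

Lemma col_recl n (f : 'I_n.+1 -> R) :
  \col_i f i = col_mx (f ord0)%:M (\col_i f (lift ord0 i)) :> 'cV[R]_(1 + n).
Proof.
apply/matrixP => i j; rewrite !mxE; case: splitP => k /= ik.
  by rewrite ord1 in ik; rewrite !mxE !ord1 eqxx mulr1n; congr f; apply: val_inj.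
by rewrite !mxE; congr f; apply: val_inj; rewrite /= ik.
Qed.

Lemma measurable_col n (e : 'I_n -> I) :
  measurable_fun setT (fun omega => \col_i Z (e i) omega).
Proof.
apply: measurable_mx => i j; under eq_fun do rewrite mxE.
exact: mZ.
Qed.

(** Keeping [S] inside the range of [e] is what makes the induction work: by injectivity the next
    coordinate [e ord0] lies outside the set already used. *)
Lemma indep_off_col n (e : 'I_n -> I) : injective e ->
  exists2 S : {fset I}, (forall i, i \in S -> exists k, i = e k) &
    indep_off P Z S (fun omega => \col_i Z (e i) omega).
Proof.
elim: n e => [|n IH] e injE.
  exists fset0 => //.
  have -> : (fun omega => \col_i Z (e i) omega) = fun=> 0%R :> 'cV[R]_0.
    by apply/funext => omega; rewrite [LHS]flatmx0.
  exact: indep_off_cst.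
have inj' : injective (e \o lift ord0) by move=> i j /injE /lift_inj.
have [S Se iS] := IH _ inj'.
exists (e ord0 |` S)%fset.
  move=> i; rewrite !inE => /orP[/eqP ->|/Se[k ->]]; first by exists ord0.
  by exists (lift ord0 k).
have e0S : e ord0 \notin S by apply/negP => /Se[k /injE].
have iV := indep_off_pair mZ iS e0S.
pose g (x : 'cV[R]_n * R) : 'cV[R]_(1 + n) := col_mx x.2%:M x.1.
have -> : (fun omega => \col_i Z (e i) omega) =
    g \o (fun omega => (\col_i Z ((e \o lift ord0) i) omega, Z (e ord0) omega)).
  by apply/funext => omega; rewrite /g /= -(col_recl (fun i => Z (e i) omega)).
apply: indep_off_comp iV; apply: measurable_mx => i j.
rewrite /g; under eq_fun do rewrite mxE.
case: splitP => k _.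
  by under eq_fun do rewrite mxE !ord1 eqxx mulr1n; exact: measurable_snd.
by apply: measurable_entry; exact: measurable_fst.
Qed.

Lemma integral_standard_normal i (h : R -> \bar R) :
  measurable_fun setT h -> (forall x, 0 <= h x) ->
  \int[P]_omega h (Z i omega) = \int[normal_prob 0 1]_z h z.
Proof.
move=> mh h0.
(* The functions are retyped over [measurableTypeR R], so that the distribution and [normal_prob]
   are measures on one measurable type. *)
have mh' : measurable_fun setT (h : measurableTypeR R -> \bar R) := mh.
have mZ' : measurable_fun setT (Z i : Omega -> measurableTypeR R) := mZ i.
pose Z' : {RV P >-> measurableTypeR R} :=
  HB.pack (Z i : Omega -> measurableTypeR R) (isMeasurableFun.Build _ _ _ _ _ mZ').
rewrite -[LHS](ge0_integral_distribution Z' mh' h0).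
apply: (@eq_measure_integral _ _ R setT (normal_prob 0 1) (distribution P Z') h) => D mD _.
exact: normZ.
Qed.

(* The coordinates are integrated out one at a time: the first one replaces [M]
   by its Schur complement. *)
Lemma gaussian_expectation n (e : 'I_n -> I) (M : 'M[R]_n) (v : 'cV[R]_n) :
  injective e -> posdef M ->
  \int[P]_omega (expR (- (2^-1) *
      quadratic_form (M - 1%:M) (\col_i Z (e i) omega)
      + dot v (M *m \col_i Z (e i) omega)))%:E =
  ((Num.sqrt (\det M))^-1 * expR (2^-1 * quadratic_form M v))%:E.
Proof.
elim: n e M v => [|n IH] e M v injE pM.
  under eq_integral do rewrite [\col__ _]flatmx0 qf0r mulmx0 /dot mulmx0 mxE
    mulr0 addr0 expR0.
  have -> : \int[P]_(_ in setT) 1 = 1 :> \bar R.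
    by rewrite -[RHS](expectation_cst P 1) unlock.
  by rewrite det_mx00 sqrtr1 invr1 mul1r
    [v]flatmx0 qf0r mulr0 expR0.
have inj' : injective (e \o lift ord0) by move=> i j /injE /lift_inj.
have [a [c [D]]] := @posdef_block R n M pM.
set N := (D - _)%R => -[a0 pN eM detM].
have [S Se iS] := indep_off_col inj'.
have e0S : e ord0 \notin S by apply/negP => /Se[k /injE].
have [s [t ev]] : exists (s : R) (t : 'cV[R]_n),
    v = (col_mx s%:M t : 'cV[R]_(1 + n)).
  exists (usubmx (v : 'cV[R]_(1 + n)) 0%R 0%R), (dsubmx (v : 'cV[R]_(1 + n))).
  by rewrite -mx11_scalar vsubmxK.
pose E (y : 'cV[R]_n) (z : R) : R := (- (2^-1) *
      quadratic_form (M - 1%:M) (col_mx z%:M y : 'cV[R]_(1 + n))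
      + dot v (M *m (col_mx z%:M y : 'cV[R]_(1 + n))))%R.
have EE y z : E y z = (- (2^-1) * (a - 1) * z ^+ 2 + (a * s + dot c t - dot c y) * z
    + (- (2^-1) * (quadratic_form D y - dot y y) + s * dot c y + dot t (D *m y)))%R.
  rewrite /E qfDl qfNl [quadratic_form 1%:M _]qfE mul1mx (@dot_col_mx R 1 n) qfE eM ev.
  rewrite !(@dot_block R n) -qfE.
  have -> : dot (z%:M : 'cV[R]_1) z%:M = (z ^+ 2)%R.
    by rewrite /dot tr_scalar_mx -scalar_mxM mxE eqxx mulr1n expr2.
  by field.
pose f (x : 'cV[R]_n * R) := (expR (E x.1 x.2))%:E.
have mf : measurable_fun setT f.
  apply: measurable_expR_EFin; rewrite /E.
  have mx : measurable_fun setT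
      (fun x : 'cV[R]_n * R => col_mx x.2%:M x.1 : 'cV[R]_(1 + n)).
    apply: measurable_mx => i j; under eq_fun do rewrite mxE.
    case: splitP => k _.
      by under eq_fun do rewrite mxE !ord1 eqxx mulr1n; exact: measurable_snd.
    by apply: measurable_entry; exact: measurable_fst.
  apply: measurable_funD.
    by apply: measurable_funM => //; exact: measurable_qf.
  by apply: measurable_dot => //; exact: measurable_mulmx.
have f0 x : 0 <= f x by rewrite lee_fin expR_ge0.
under eq_integral => omega _ do
  rewrite (col_recl (fun i => Z (e i) omega)) -[X in (expR X)%:E]/(E _ _).
rewrite -[LHS]/(\int[P]_omega
  f (\col_i Z ((e \o lift ord0) i) omega, Z (e ord0) omega)).
rewrite (indep_off_integral mZ iS e0S mf f0).
(* [k] collects what is free of [y] after integration over the first coordinate; the rest of the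
   squared coefficient of [z] turns [D] into the Schur complement [N]. *)
pose k := ((Num.sqrt a)^-1 * expR (2^-1 * ((a * s + dot c t) ^+ 2 / a)))%R.
have k0 : (0 <= k)%R by rewrite mulr_ge0 ?expR_ge0 // invr_ge0 sqrtr_ge0.
have inner y : \int[P]_omega f (y, Z (e ord0) omega) =
    k%:E * (expR (- (2^-1) * quadratic_form (N - 1%:M) y + dot t (N *m y)))%:E.
  rewrite (@integral_standard_normal (e ord0) (fun z => f (y, z))) //; last first.
    by apply: (measurableT_comp mf); exact: measurable_fun_pair.
  pose r := (- (2^-1) * (quadratic_form D y - dot y y) + s * dot c y + dot t (D *m y))%R.
  under eq_integral do rewrite /f /= EE expRD mulrC EFinM -/r.
  rewrite ge0_integralZl //=; last exact: measurable_exp_quadratic.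
  rewrite integral_normal_exp // -!EFinM; congr EFin.
  rewrite /k mulrCA -!mulrA -!expRD; congr (_ * expR _)%R.
  rewrite /r /N !qfE !mulmxBl !mul1mx -!scalemxAl !dotDr !dotNr !dotZr !dot_outer.
  by field; rewrite gt_eqF.
under eq_integral do rewrite inner.
rewrite ge0_integralZl //; last first.
  apply: measurable_expR_EFin; apply: measurable_funD.
    apply: measurable_funM => //; apply: measurable_qf; exact: measurable_col.
  by apply: measurable_dot => //; apply: measurable_mulmx => //; exact: measurable_col.
rewrite IH // -EFinM; congr EFin.
rewrite detM sqrtrM ?ltW // invfM /k mulrACA -expRD; congr (_ * expR _)%R.
rewrite !qfE {1}eM ev (@dot_block R n) /N mulmxBl -scalemxAl dotDr dotNr dotZr dot_outer.
by field; rewrite gt_eqF.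
Qed.

End gaussian_vector.

Section gaussian_shift.
Context {dO : measure_display} {Omega : measurableType dO} {R : realType}.
Variable P : probability Omega R.

(** Identifies the factor in the stability hypothesis. The transpose of the matrix to invert is [W]
    times the gap, and the gap times [1%:M + worst_noise W beta S] is [invmx W]. *)
Lemma worst_noise_inv n (W S : 'M[R]_n) (beta : R) :
  posdef W -> admissible W beta S ->
  (invmx (1%:M - beta *: (S *m W)))^T = 1%:M + worst_noise W beta S.
Proof.
move=> pW [symS _ pG]; have [symW _] := pW.
have uW := posdef_unit pW; have uG := posdef_unit pG.
rewrite trmx_inv; set U := (_ - _)^T; set Y := 1%:M + _.
have UY : U *m Y = 1%:M.
  have -> : U = W *m robust_gap W beta S.
    rewrite /U /robust_gap linearB linearZ /= trmx1 trmx_mul symS symW.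
    by rewrite mulmxBr mulmxV // -scalemxAr.
  rewrite -mulmxA /Y /worst_noise mulmxDr mulmx1 -scalemxAr mulKVmx //.
  by rewrite /robust_gap subrK mulmxV.
have [uU _] := mulmx1_unit UY.
by rewrite -[RHS]mul1mx -(mulVmx uU) -mulmxA UY mulmx1.
Qed.

Lemma det_gap n (W S : 'M[R]_n) (beta : R) : posdef W ->
  \det (1%:M - beta *: (S *m W)) = \det W * \det (robust_gap W beta S).
Proof.
move=> pW; have uW := posdef_unit pW.
rewrite mulrC -det_mulmx; congr (\det _).
by rewrite /robust_gap mulmxBl mulVmx // -scalemxAl.
Qed.

Lemma det_gap_gt0 n (W S : 'M[R]_n) (beta : R) : posdef W -> admissible W beta S ->
  0 < \det (1%:M - beta *: (S *m W)).
Proof. by move=> pW [_ _ pG]; rewrite det_gap // mulr_gt0 // posdef_det. Qed.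

(** Writing [X] as [L] times a standard vector brings the exponent to the form of
    [gaussian_expectation], with matrix [L^T *m G *m L] for the gap [G] and with [v] the worst noise
    read through [invmx L]. *)
Lemma gaussian_shift n (W S : 'M[R]_n) (beta : R) (X : {RV P >-> 'cV[R]_n})
    (y : 'cV[R]_n) :
  posdef W -> 0 < beta -> admissible W beta S -> centered_gaussian W X ->
  (\int[P]_omega (expR (beta / 2 * quadratic_form S (y + X omega)))%:E =
   ((Num.sqrt (\det (1%:M - beta *: (S *m W))))^-1
     * expR (beta / 2 * quadratic_form (tilde W beta S) y))%:E)%E.
Proof.
move=> pW b0 aS [L [Z [LL normZ indZ XE]]].
have [symS S0 pG] := aS; have [symG _] := pG.
have uW := posdef_unit pW; have uG := posdef_unit pG.
have uL : L \in unitmx by move: uW; rewrite -LL unitmx_mul => /andP[].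
set G := robust_gap W beta S in pG symG uG.
pose M := L^T *m G *m L.
have pM : posdef M by exact: posdef_congr.
have [symM _] := pM.
have M1 : M - 1%:M = - (beta *: (L^T *m S *m L)).
  rewrite /M /G /robust_gap mulmxBr mulmxBl.
  have -> : L^T *m invmx W *m L = 1%:M.
    by rewrite -mulmxA; apply: mulmx1C; rewrite -mulmxA LL mulVmx.
  by rewrite addrAC subrr add0r -scalemxAr -scalemxAl.
pose v := invmx L *m (worst_noise W beta S *m y).
have Mv : M *m v = beta *: (L^T *m (S *m y)).
  rewrite /M /v -!mulmxA mulKVmx // /worst_noise -scalemxAl -!scalemxAr.
  by rewrite -[invmx _ *m S *m y]mulmxA mulKVmx.
have detM : \det M = \det (1%:M - beta *: (S *m W)).
  have -> : \det (1%:M - beta *: (S *m W)) = \det L * \det L * \det G.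
    by rewrite det_gap // -[X in \det X * _]LL det_mulmx det_tr.
  by rewrite /M !det_mulmx det_tr mulrAC.
have qMv : quadratic_form M v = quadratic_form G (worst_noise W beta S *m y).
  by rewrite /M qf_congr /v mulKVmx.
have e z : beta / 2 * quadratic_form S (y + L *m z) =
    (- 2^-1 * quadratic_form (M - 1%:M) z + dot v (M *m z))
    + beta / 2 * quadratic_form S y.
  rewrite qfD // M1 qfNl qfZl qf_congr.
  have -> : dot v (M *m z) = beta * dot y (S *m (L *m z)).
    rewrite dotC dot_mull symM Mv dotZr dotC !dot_mull trmxK symS.
    by [].
  by field.
under eq_integral do rewrite XE e expRD mulrC EFinM.
have mcol : measurable_fun setT (fun omega => \col_i Z i omega).
  exact: (measurable_col (fun i => Z i) id).
rewrite ge0_integralZl //; last first.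
  apply: measurable_expR_EFin; apply: measurable_funD.
    by apply: measurable_funM => //; exact: measurable_qf.
  by apply: measurable_dot => //; exact: measurable_mulmx.
rewrite (gaussian_expectation indZ normZ v (@inj_id _) pM) -EFinM; congr EFin.
rewrite detM mulrCA -expRD; congr (_ * expR _).
(* At zero noise, [tilde_max] says that the square completed here is the difference between [tilde]
   and [S]. *)
have := tilde_max b0 y 0 aS.
rewrite addr0 qf0r mulr0 subr0 sub0r qfNr -/G qMv => ->.
by field; rewrite gt_eqF.
Qed.

End gaussian_shift.

(** * Cost of a policy *)

Lemma measurable_rcons {dT dE : measure_display} {T : measurableType dT}
    {E : measurableType dE} t (f : T -> t.-tuple E) (g : T -> E) :
  measurable_fun setT f -> measurable_fun setT g ->
  measurable_fun setT (fun x => [tuple of rcons (f x) (g x)] : t.+1.-tuple E).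
Proof.
move=> mf mg; apply/measurable_fun_tnthP => i.
have [it|it] := ltnP i t.
  have -> : @tnth t.+1 E ^~ i \o (fun x => [tuple of rcons (f x) (g x)])
      = (@tnth t E ^~ (Ordinal it)) \o f.
    apply/funext => x /=.
    by rewrite !(tnth_nth (g x)) /= nth_rcons size_tuple it.
  exact: measurableT_comp (measurable_tnth _) mf.
have -> : @tnth t.+1 E ^~ i \o (fun x => [tuple of rcons (f x) (g x)]) = g.
  apply/funext => x /=; rewrite (tnth_nth (g x)) /= nth_rcons size_tuple ltnNge it /=.
  by case: eqP => // _; rewrite nth_default ?size_tuple.
exact: mg.
Qed.

Section leqg.
Context {R : realType} {m d : nat}.
Variables (A : 'M[R]_m) (B : 'M[R]_(m, d)) (Q : 'M[R]_m) (Ru : 'M[R]_d).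
Variables (X0 W : 'M[R]_m) (beta : R).
Context {dO : measure_display} {Omega : measurableType dO}.
Variables (P : probability Omega R).
Variables (x0 : {RV P >-> 'cV[R]_m}) (w : nat -> {RV P >-> 'cV[R]_m}).
Hypotheses (pQ : posdef Q) (pR : posdef Ru) (pX0 : posdef X0) (pW : posdef W).
Hypothesis beta0 : 0 < beta.
Hypothesis gx0 : centered_gaussian X0 x0.
Hypothesis gw : forall t, centered_gaussian W (w t).

(** The initial state takes index 0, so that the history at time [t] depends on indices up to [t]
    and the next noise [w t] has the fresh index [t.+1]. *)
Definition driving_noise (n : nat) : Omega -> 'cV[R]_m :=
  if n is t.+1 then w t : Omega -> 'cV[R]_m else x0.

Hypothesis ind : mutually_independent P driving_noise.

Let measurable_noise n : measurable_fun setT (driving_noise n).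
Proof. by case: n => [|n]; exact: measurable_funPT. Qed.

Local Notation riccati := (riccati A B Q W Ru beta).
Local Notation gain := (gain A B W Ru beta).
Local Notation tilde := (tilde W beta).
Local Notation value_iteration := (value_iteration A B Q W Ru beta).

(** The multiplier of the exponential cost in one step is the inverse square root of this
    determinant. *)
Definition growth (Y : 'M[R]_m) : R := \det (1%:M - beta *: (Y *m W)).

Section policy.
Variable mu : policy R m d.
Hypothesis mmu : measurable_policy mu.

Let measurable_mu t : measurable_fun setT (@mu t).
Proof. exact: mmu. Qed.

Definition history_at t omega := trajectory A B mu (x0 omega) (w^~ omega) t.
Definition cost_at t omega := total_cost A B Q Ru x0 (fun t => w t) mu t omega.

Lemma cost_at_recr t omega : cost_at t.+1 omega =
  cost_at t omega + stage_cost Q Ru (history_at t omega).2 (mu (history_at t omega)).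
Proof. by rewrite /cost_at /total_cost big_ord_recr. Qed.

Lemma measurable_stage_cost {dT} {T : measurableType dT} (x : T -> 'cV[R]_m)
    (u : T -> 'cV[R]_d) :
  measurable_fun setT x -> measurable_fun setT u ->
  measurable_fun setT (fun z => stage_cost Q Ru (x z) (u z)).
Proof. by move=> mx mu'; apply: measurable_funD; exact: measurable_qf. Qed.

Let measurable_drift t : measurable_fun setT
  (fun z : R * history R m d t => A *m z.2.2 + B *m mu z.2).
Proof.
apply: measurable_addmx; apply: measurable_mulmx => //.
  exact: (measurableT_comp measurable_snd measurable_snd).
exact: (measurableT_comp (@measurable_mu t) measurable_snd).
Qed.

Let measurable_step_cost t : measurable_fun setT
  (fun z : R * history R m d t => z.1 + stage_cost Q Ru z.2.2 (mu z.2)).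
Proof.
apply: measurable_funD => //; apply: measurable_stage_cost.
  exact: (measurableT_comp measurable_snd measurable_snd).
exact: (measurableT_comp (@measurable_mu t) measurable_snd).
Qed.

(** By induction, cost and history are measurable functions of the noises up to index [t]. They are
    carried as a pair because the integrand of [value_step] involves both. *)
Lemma indep_off_history t : exists2 S : {fset nat},
  (forall i, i \in S -> (i <= t)%N) &
  indep_off P driving_noise S (fun omega => (cost_at t omega, history_at t omega)).
Proof.
elim: t => [|t [S St iS]].
  exists (0%N |` fset0)%fset; first by move=> i; rewrite !inE orbF => /eqP ->.
  pose g (z : R * 'cV[R]_m) : R * history R m d 0 := (z.1, ([tuple], z.2)).
  have -> : (fun omega => (cost_at 0 omega, history_at 0 omega)) =
      g \o (fun omega => (0, driving_noise 0 omega)).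
    by apply/funext => omega; rewrite /g /= /cost_at /total_cost big_ord0.
  apply: indep_off_comp.
    apply: measurable_fun_pair => //; apply: measurable_fun_pair => //.
  by apply: (indep_off_pair measurable_noise (indep_off_cst ind (0 : R))).
have tS : t.+1 \notin S by apply/negP => /St; rewrite ltnn.
exists (t.+1 |` S)%fset.
  by move=> i; rewrite !inE => /orP[/eqP ->//|/St /leqW].
pose g (z : (R * history R m d t) * 'cV[R]_m) : R * history R m d t.+1 :=
  (z.1.1 + stage_cost Q Ru z.1.2.2 (mu z.1.2),
   ([tuple of rcons z.1.2.1 (z.1.2.2, mu z.1.2)],
    A *m z.1.2.2 + B *m mu z.1.2 + z.2)).
have -> : (fun omega => (cost_at t.+1 omega, history_at t.+1 omega)) =
    g \o (fun omega => ((cost_at t omega, history_at t omega), driving_noise t.+1 omega)).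
  by apply/funext => omega; rewrite /g /= -cost_at_recr.
apply: indep_off_comp; last exact: (indep_off_pair measurable_noise iS tS).
apply: measurable_fun_pair.
  exact: (measurableT_comp (@measurable_step_cost t) measurable_fst).
apply: measurable_fun_pair.
  have mh : measurable_fun setT
      (fun z : (R * history R m d t) * 'cV[R]_m => z.1.2).
    exact: (measurableT_comp measurable_snd measurable_fst).
  apply: measurable_rcons.
    exact: (measurableT_comp measurable_fst mh).
  apply: measurable_fun_pair.
    exact: (measurableT_comp measurable_snd mh).
  exact: (measurableT_comp (@measurable_mu t) mh).
apply: measurable_addmx => //.
exact: (measurableT_comp (@measurable_drift t) measurable_fst).
Qed.

Definition exp_value t (Y : 'M[R]_m) : \bar R :=
  (\int[P]_omega (expR (beta / 2 * (cost_at t omega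
     + quadratic_form Y (history_at t omega).2)))%:E)%E.

Let measurable_value t Y : measurable_fun setT (fun omega =>
  (expR (beta / 2 * (cost_at t omega + quadratic_form Y (history_at t omega).2)))%:E).
Proof.
have [S _ [mV _]] := indep_off_history t.
apply: measurable_expR_EFin; apply: measurable_funM => //; apply: measurable_funD.
  exact: (measurableT_comp measurable_fst mV).
apply: measurable_qf.
exact: (measurableT_comp (measurableT_comp measurable_snd measurable_snd) mV).
Qed.

Let measurable_drift_value t Y : measurable_fun setT (fun omega =>
  (expR (beta / 2 * (cost_at t.+1 omega + quadratic_form Y
      (A *m (history_at t omega).2 + B *m mu (history_at t omega)))))%:E).
Proof.
have [S _ [mV _]] := indep_off_history t.
apply: measurable_expR_EFin; apply: measurable_funM => //; apply: measurable_funD.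
  have -> : cost_at t.+1 = (fun z : R * history R m d t =>
      z.1 + stage_cost Q Ru z.2.2 (mu z.2)) \o
      (fun omega => (cost_at t omega, history_at t omega)).
    by apply/funext => omega; exact: cost_at_recr.
  exact: (measurableT_comp (@measurable_step_cost t) mV).
by apply: measurable_qf; exact: (measurableT_comp (@measurable_drift t) mV).
Qed.

(** The fresh noise is independent of the past, so it is integrated out with the history frozen;
    [gaussian_shift] then replaces [Y] by [tilde Y] at the drift. *)
Lemma value_step t Y : admissible W beta Y ->
  exp_value t.+1 Y = (((Num.sqrt (growth Y))^-1)%:E *
    \int[P]_omega (expR (beta / 2 * (cost_at t.+1 omega + quadratic_form (tilde Y)
      (A *m (history_at t omega).2 + B *m mu (history_at t omega)))))%:E)%E.
Proof.
move=> aY; have [S St iS] := indep_off_history t.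
have tS : t.+1 \notin S by apply/negP => /St; rewrite ltnn.
pose f (z : (R * history R m d t) * 'cV[R]_m) : \bar R :=
  (expR (beta / 2 * ((z.1.1 + stage_cost Q Ru z.1.2.2 (mu z.1.2))
    + quadratic_form Y (A *m z.1.2.2 + B *m mu z.1.2 + z.2))))%:E.
have mf : measurable_fun setT f.
  apply: measurable_expR_EFin; apply: measurable_funM => //.
  apply: measurable_funD.
    exact: (measurableT_comp (@measurable_step_cost t) measurable_fst).
  apply: measurable_qf; apply: measurable_addmx => //.
  exact: (measurableT_comp (@measurable_drift t) measurable_fst).
have f0 z : (0 <= f z)%E by rewrite lee_fin expR_ge0.
have -> : exp_value t.+1 Y =
    (\int[P]_omega f ((cost_at t omega, history_at t omega), driving_noise t.+1 omega))%E.
  by apply: eq_integral => omega _; rewrite cost_at_recr.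
rewrite (indep_off_integral measurable_noise iS tS mf f0).
have inner z : (\int[P]_omega f (z, driving_noise t.+1 omega))%E =
    (((Num.sqrt (growth Y))^-1)%:E *
    (expR (beta / 2 * ((z.1 + stage_cost Q Ru z.2.2 (mu z.2)) + quadratic_form (tilde Y)
      (A *m z.2.2 + B *m mu z.2))))%:E)%E.
  under eq_integral do rewrite /f /= mulrDr expRD EFinM.
  rewrite ge0_integralZl //=; last first.
    apply: measurable_expR_EFin; apply: measurable_funM => //.
    by apply: measurable_qf; exact: measurable_addmx.
  rewrite (gaussian_shift _ pW beta0 aY (gw t)) -!EFinM; congr EFin.
  by rewrite mulrCA -expRD -mulrDr.
under eq_integral do rewrite inner /= -cost_at_recr.
by rewrite ge0_integralZl // lee_fin invr_ge0 sqrtr_ge0.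
Qed.

Let beta2 : 0 <= beta / 2. Proof. by rewrite divr_ge0 // ltW. Qed.

Lemma value_ge t Y : admissible W beta Y ->
  (((Num.sqrt (growth Y))^-1)%:E * exp_value t (riccati Y) <= exp_value t.+1 Y)%E.
Proof.
move=> aY; rewrite value_step //; apply: lee_wpmul2l.
  by rewrite lee_fin invr_ge0 sqrtr_ge0.
apply: ge0_le_integral => // omega _.
rewrite lee_fin ler_expR ler_wpM2l // cost_at_recr -addrA lerD2l.
  exact: riccati_le.
Qed.

Lemma value_le t Y : admissible W beta Y ->
  (forall h : history R m d t, mu h = - (gain Y *m h.2)) ->
  (exp_value t.+1 Y <= ((Num.sqrt (growth Y))^-1)%:E * exp_value t (riccati Y))%E.
Proof.
move=> aY muE; rewrite value_step //; apply: lee_wpmul2l.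
  by rewrite lee_fin invr_ge0 sqrtr_ge0.
apply: ge0_le_integral => // omega _.
rewrite lee_fin ler_expR ler_wpM2l // cost_at_recr -addrA lerD2l.
  by rewrite muE riccati_gain // mulmxN mulmxA -mulmxBl.
Qed.

Lemma value0_ge1 Y : (forall v, 0 <= quadratic_form Y v) -> (1 <= exp_value 0 Y)%E.
Proof.
move=> Y0; rewrite -(expectation_cst P 1) unlock; apply: ge0_le_integral => //.
  by apply/measurable_EFinP; exact: measurable_cst.
move=> omega _; rewrite lee_fin -[leLHS]expR0 ler_expR mulr_ge0 //.
  by rewrite /cost_at /total_cost big_ord0 add0r.
Qed.

(** Finiteness of the initial expectation, which is where admissibility relative to [X0] enters. The
    constant disappears after division by the horizon. *)
Lemma value0E Y : admissible X0 beta Y -> exists C, exp_value 0 Y = (expR C)%:E.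
Proof.
move=> aY; have := gaussian_shift 0 pX0 beta0 aY gx0.
under eq_integral do rewrite add0r.
rewrite qf0r mulr0 expR0 mulr1 => e.
have D0 : 0 < \det (1%:M - beta *: (Y *m X0)) by exact: det_gap_gt0.
exists (ln (Num.sqrt (\det (1%:M - beta *: (Y *m X0))))^-1).
rewrite lnK ?posrE ?invr_gt0 ?sqrtr_gt0 // -e; apply: eq_integral => omega _.
by rewrite /cost_at /total_cost big_ord0 add0r.
Qed.

Lemma invr_sqrt_exp (D : R) : 0 < D -> (Num.sqrt D)^-1 = expR (- (2^-1 * ln D)).
Proof.
move=> D0; rewrite expRN; congr (_^-1); rewrite -[in LHS](lnK D0).
set x := ln D; rewrite [in LHS](_ : x = 2^-1 * x + 2^-1 * x); last by field.
by rewrite expRD -expr2 sqrtr_sqr ger0_norm ?expR_ge0.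
Qed.

(** [value_ge] trades one step of time for one Riccati step: the iterate index grows as time
    decreases, so the induction on [t] leaves [j] free. *)
Lemma value_lower t j : (forall k, admissible W beta (value_iteration k)) ->
  ((expR (- (2^-1 * \sum_(j <= i < j + t) ln (growth (value_iteration i)))))%:E
    <= exp_value t (value_iteration j))%E.
Proof.
move=> aY; elim: t j => [|t IH] j.
  rewrite addn0 big_geq // mulr0 oppr0 expR0; apply: value0_ge1.
  by case: (aY j).
apply: le_trans (value_ge t (aY j)).
have D0 : 0 < growth (value_iteration j) by exact: det_gap_gt0.
rewrite addnS big_ltn ?ltnS ?leq_addr // mulrDr opprD expRD EFinM invr_sqrt_exp //.
apply: lee_wpmul2l; first by rewrite lee_fin expR_ge0.
by have := IH j.+1; rewrite addSn.
Qed.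

Lemma value_upper t Y : admissible W beta Y -> riccati Y = Y ->
  (forall t (h : history R m d t), mu h = - (gain Y *m h.2)) ->
  (exp_value t Y <= (expR (- (2^-1 * t%:R * ln (growth Y))))%:E * exp_value 0 Y)%E.
Proof.
move=> aY fY muE; have D0 : 0 < growth Y by exact: det_gap_gt0.
elim: t => [|t IH]; first by rewrite mulr0 mul0r oppr0 expR0 mul1e.
apply: (le_trans (value_le aY (@muE t))).
rewrite fY invr_sqrt_exp //.
apply: (le_trans (lee_wpmul2l _ IH)); first by rewrite lee_fin expR_ge0.
rewrite muleA -EFinM -expRD lee_wpmul2r //.
  by apply: integral_ge0 => omega _; rewrite lee_fin expR_ge0.
by rewrite lee_fin ler_expR -natr1; lra.
Qed.

Lemma leqg_costE t : leqg_cost A B Q Ru beta P x0 w mu t =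
  ((t%:R^-1 * (2 / beta))%:E * lne (exp_value t 0))%E.
Proof.
rewrite /leqg_cost unlock; congr (_ * lne _)%E.
by apply: eq_integral => omega _; rewrite qf0l addr0.
Qed.

(** Lets the zero terminal weight of the actual cost be replaced by [PK] in the upper bound. *)
Lemma value_nondec t Y : (forall v, 0 <= quadratic_form Y v) ->
  (exp_value t 0 <= exp_value t Y)%E.
Proof.
move=> Y0; apply: ge0_le_integral => // omega _.
by rewrite lee_fin ler_expR ler_wpM2l // lerD2l qf0l; exact: Y0.
Qed.

End policy.

Lemma measurable_linear_state_feedback (K : 'M[R]_(d, m)) :
  measurable_policy (linear_state_feedback K).
Proof.
move=> t; rewrite /linear_state_feedback.
apply: measurable_mx => i j; under eq_fun do rewrite mxE.
apply: measurableT_comp => //; apply: measurable_entry.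
by apply: measurable_mulmx => //; exact: measurable_snd.
Qed.

(** * Two-sided bounds and the limit of the average cost *)

Variable PK : 'M[R]_m.
Hypotheses (aP : admissible W beta PK) (aP0 : admissible X0 beta PK).
Hypothesis fP : riccati PK = PK.
Hypothesis stable : spectral_radius (closed_loop A B W Ru beta PK) < 1.

Let lower t : R :=
  - beta^-1 * (t%:R^-1 * \sum_(0 <= i < t) ln (growth (value_iteration i))).

Let admissible_value_iteration k : admissible W beta (value_iteration k).
Proof.
apply: (value_iteration_le pQ pR pW beta0 aP _ k).1 => v.
by rewrite fP.
Qed.

Lemma lower_cvg : lower t @[t --> \oo] --> - beta^-1 * ln (growth PK).
Proof.
have YP := value_iteration_cvg pQ pR pW beta0 aP fP stable.
apply: cvgM; first exact: cvg_cst.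
have gP : ln (growth (value_iteration k)) @[k --> \oo] --> ln (growth PK).
  apply: (@continuous_cvg _ _ _ _ _ (fun k => growth (value_iteration k)) (@ln R)).
    by apply: continuous_ln; exact: det_gap_gt0.
  apply: mx_cvg_det; apply: mx_cvgD; first exact: mx_cvg_cst.
  by apply: mx_cvgN; apply: mx_cvgZ; apply: mx_cvgM => //; exact: mx_cvg_cst.
(* [cesaro] averages the first [t.+1] terms, hence the index shift. *)
have := cesaro gP.
by rewrite -(cvg_shiftS
  (fun t => t%:R^-1 * \sum_(0 <= i < t) ln (growth (value_iteration i)))).
Qed.

Lemma lower_le mu t : measurable_policy mu ->
  ((lower t)%:E <= leqg_cost A B Q Ru beta P x0 w mu t)%E.
Proof.
move=> mmu; rewrite leqg_costE.
have := value_lower mmu t 0 admissible_value_iteration.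
rewrite add0n => h.
apply: (@le_trans _ _ ((t%:R^-1 * (2 / beta))%:E *
  lne (expR (- (2^-1 * \sum_(0 <= i < t) ln (growth (value_iteration i)))))%:E)%E).
  rewrite lne_EFin ?expR_gt0 // expRK -EFinM lee_fin le_eqVlt; apply/orP; left.
  (* The identity is linear in the factor [t%:R^-1], so it also covers [t = 0], where this factor is
     0. *)
  by apply/eqP; rewrite /lower; move: (t%:R^-1) => y; field; rewrite gt_eqF.
apply: lee_wpmul2l.
  by rewrite lee_fin mulr_ge0 // divr_ge0 // ltW.
rewrite lee_lne // ?in_itv /= ?leey ?andbT ?lee_fin ?expR_ge0 //.
by apply: le_trans h; rewrite lee_fin expR_ge0.
Qed.

(** At a fixed point every step contributes the same factor, so the logarithm is affine in the
    horizon; [C] is the logarithm of the initial expectation. *)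
Lemma upper_ge : exists C : R, forall t,
  (leqg_cost A B Q Ru beta P x0 w (linear_state_feedback (gain PK)) t <=
   (t%:R^-1 * (2 / beta) * (C - 2^-1 * t%:R * ln (growth PK)))%:E)%E.
Proof.
have mmu := measurable_linear_state_feedback (gain PK).
have [C vC] := value0E (linear_state_feedback (gain PK)) aP0.
exists C => t; rewrite leqg_costE [leRHS]EFinM.
apply: lee_wpmul2l.
  by rewrite lee_fin mulr_ge0 // divr_ge0 // ltW.
rewrite -[X in (_ <= X%:E)%E]expRK -lne_EFin ?expR_gt0 //.
have := value_upper mmu t aP fP (fun _ _ => erefl).
rewrite vC -EFinM -expRD addrC => h.
have [symP P0 _] := aP.
have h' := le_trans (value_nondec mmu t P0) h.
rewrite lee_lne // ?in_itv /= ?leey ?andbT ?lee_fin ?expR_ge0 //.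
by apply: integral_ge0 => omega _; rewrite lee_fin expR_ge0.
Qed.

Lemma leqg_cost_cvg :
  leqg_cost A B Q Ru beta P x0 w (linear_state_feedback (gain PK)) @ \oo -->
    (- beta^-1 * ln (growth PK))%:E.
Proof.
have [C upper] := upper_ge.
apply: (@squeeze_cvge _ _ _ _ (EFin \o lower) _
  (fun t => (t%:R^-1 * (2 / beta) * (C - 2^-1 * t%:R * ln (growth PK)))%:E)).
- apply: nearW => t; rewrite upper andbT lower_le //.
  exact: measurable_linear_state_feedback.
- by apply: cvg_EFin; [exact: nearW|exact: lower_cvg].
- apply: cvg_EFin; first exact: nearW.
  (* After the shift the divisor is nonzero, and the bound becomes a harmonic term plus the
     limit. *)
  rewrite -(cvg_shiftS
    (fun t => t%:R^-1 * (2 / beta) * (C - 2^-1 * t%:R * ln (growth PK)))).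
  have -> : (fun t => t.+1%:R^-1 * (2 / beta) * (C - 2^-1 * t.+1%:R * ln (growth PK)))
     = (fun t => harmonic t * (2 / beta * C) + - beta^-1 * ln (growth PK)).
    apply/funext => t; rewrite /harmonic /=; field.
    by rewrite gt_eqF //= addrC natr1 pnatr_eq0.
  have h : harmonic t * (2 / beta * C) + - beta^-1 * ln (growth PK) @[t --> \oo]
      --> 0 * (2 / beta * C) + - beta^-1 * ln (growth PK).
    apply: cvgD; last exact: cvg_cst.
    by apply: cvgM; [exact: cvg_harmonic|exact: cvg_cst].
  by rewrite mul0r add0r in h.
Qed.

Lemma leqg_minimum :
  is_minimum (leqg_objectives A B Q Ru beta P x0 w)
    (- beta^-1 * ln (growth PK))%:E.
Proof.
split.
  exists (linear_state_feedback (gain PK)); last exact: leqg_cost_cvg.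
  exact: measurable_linear_state_feedback.
move=> l [mu mmu mul].
(* The lower bound is the same for all policies and already tends to the claimed value, so comparing
   limits suffices. *)
have lJ : (lower t)%:E @[t --> \oo] --> (- beta^-1 * ln (growth PK))%:E.
  by apply: cvg_EFin; [exact: nearW|exact: lower_cvg].
by apply: (lee_cvg_to lJ mul); apply: nearW => t; exact: lower_le.
Qed.

End leqg.

Theorem lemmaC2 (R : realType) (m d : nat)
  (A : 'M[R]_m) (B : 'M[R]_(m, d)) (Q : 'M[R]_m) (Ru : 'M[R]_d)
  (X0 W : 'M[R]_m) (beta : R)
  (dO : measure_display) (Omega : measurableType dO)
  (P : probability Omega R)
  (x0 : {RV P >-> 'cV[R]_m}) (w : nat -> {RV P >-> 'cV[R]_m})
  (PK PKt : 'M[R]_m) (K : 'M[R]_(d, m)) :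
  posdef Q -> posdef Ru -> posdef X0 -> posdef W -> 0 < beta ->
  centered_gaussian X0 x0 ->
  (forall t, centered_gaussian W (w t)) ->
  mutually_independent P
    (fun n : nat => if n is t.+1 then w t : Omega -> 'cV[R]_m else x0) ->
  PK = Q + K^T *m Ru *m K + (A - B *m K)^T *m PKt *m (A - B *m K) ->
  PKt = PK + beta *: (PK *m invmx (invmx W - beta *: PK) *m PK) ->
  K = invmx (Ru + B^T *m PKt *m B) *m B^T *m PKt *m A ->
  possemidef PK ->
  posdef (invmx W - beta *: PK) ->
  spectral_radius
    ((invmx (1%:M - beta *: (PK *m W)))^T *m (A - B *m K)) < 1 ->
  posdef (invmx X0 - beta *: PK) ->
  is_minimum (leqg_objectives A B Q Ru beta P x0 w)
    (- beta^-1 * ln (\det (1%:M - beta *: (PK *m W))))%:E /\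
  optimal_policy A B Q Ru beta P x0 w (linear_state_feedback K).
Proof.
move=> pQ pR pX0 pW b0 gx0 gw ind ePK ePKt eK [symPK PK0] pG stable pG0.
have aP : admissible W beta PK by [].
have aP0 : admissible X0 beta PK by [].
have eT : tilde W beta PK = PKt by rewrite ePKt.
have eg : gain A B W Ru beta PK = K by rewrite /gain eT -eK.
have fP : riccati A B Q W Ru beta PK = PK by rewrite /riccati eg eT -ePK.
have st : spectral_radius (closed_loop A B W Ru beta PK) < 1.
  by rewrite /closed_loop eg -worst_noise_inv.
have min := leqg_minimum pQ pR pX0 pW b0 gx0 gw ind aP aP0 fP st.
have cvg := leqg_cost_cvg pQ pR pX0 pW b0 gx0 gw ind aP aP0 fP st.
rewrite eg in cvg; split => //; split.
  exact: measurable_linear_state_feedback.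
by eexists; [exact: cvg|].
Qed.
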